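(* If $\ell$ is a positive integer, then the third central moment of the autocorrelation demerit factor over uniformly random binary sequences of length $\ell$ is \[ \mu_{3,f}^{\ell}\,\mathrm{ADF}(f)= \begin{cases} \frac{160\ell^4-1296\ell^3+3296\ell^2-2496\ell}{\ell^6} & \text{if } \ell \equiv 0 \pmod 4,\\[4pt] \frac{160\ell^4-1296\ell^3+3296\ell^2-2736\ell+576}{\ell^6} & \text{if } \ell \equiv \pm 1 \pmod 4,\\[4pt] \frac{160\ell^4-1296\ell^3+3296\ell^2-2496\ell-384}{\ell^6} & \text{if } \ell \equiv 2 \pmod 4, \end{cases} \] and the third standardized moment (skewness) is \[ \tilde{\mu}_{3,f}^{\ell}\,\mathrm{ADF}(f)= \begin{cases} \frac{6\sqrt{3}\,(10\ell^4-81\ell^3+206\ell^2-156\ell)}{(4\ell^3-15\ell^2+14\ell)^{3/2}} & \text{if } \ell \equiv 0 \pmod 4,\\[4pt] \frac{6\sqrt{3}\,(10\ell^4-81\ell^3+206\ell^2-171\ell+36)}{(4\ell^3-15\ell^2+14\ell-3)^{3/2}} & \text{if } \ell \equiv \pm 1 \pmod 4,\\[4pt] \frac{6\sqrt{3}\,(10\ell^4-81\ell^3+206\ell^2-156\ell-24)}{(4\ell^3-15\ell^2+14\ell)^{3/2}} & \text{if } \ell \equiv 2 \pmod 4. \end{cases} \]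
   Context: A sequence is a doubly infinite list $f=(\ldots,f_{-1},f_0,f_1,\ldots)$ of complex numbers with only finitely many nonzero terms. A binary sequence of length $\ell$ is a sequence with $f_j\in\{-1,1\}$ for $0\le j\le \ell-1$ and $f_j=0$ for all other $j\in\mathbb{Z}$; $\mathrm{Seq}(\ell)$ is the set of all $2^\ell$ of them with the uniform probability measure. The aperiodic autocorrelation of $f$ at shift $s\in\mathbb{Z}$ is $C_f(s)=\sum_{j\in\mathbb{Z}} f_{j+s}\overline{f_j}$. The autocorrelation demerit factor of a nonzero sequence $f$ is $\mathrm{ADF}(f)=\frac{\sum_{s\in\mathbb{Z}, s\neq 0}|C_f(s)|^2}{C_f(0)^2}$. For a random variable $v(f)$ with $f$ uniform in $\mathrm{Seq}(\ell)$, $\mathbb{E}_f^\ell v(f)$ is its expected value, the $p$th central moment is $\mu_{p,f}^\ell v(f)=\mathbb{E}_f^\ell\big(v(f)-\mathbb{E}_f^\ell v(f)\big)^p$, and the $p$th standardized moment is $\tilde\mu_{p,f}^\ell v(f)=\mu_{p,f}^\ell v(f)/\big(\mu_{2,f}^\ell v(f)\big)^{p/2}$. *)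

(* Defs.v *)
From mathcomp Require Import all_boot all_order all_algebra.
From mathcomp Require Import finmap complex.
From mathcomp Require Import all_classical all_reals all_analysis.

Set Implicit Arguments.
Unset Strict Implicit.
Unset Printing Implicit Defensive.

Import Order.TTheory GRing.Theory Num.Theory.

Local Open Scope classical_set_scope.
Local Open Scope ring_scope.

Definition cseq (R : realType) := {fsfun int -> R[i] with 0}.

Definition binary_seqs (R : realType) (l : nat) : set (cseq R) :=
  [set f : cseq R |
    forall j : int, if 0 <= j < l%:Z then f j = 1 \/ f j = -1 else f j = 0].
Arguments binary_seqs R l : clear implicits.

Definition autocorr (R : realType) (f : cseq R) (s : int) : R[i] :=
  \sum_(j \in [set: int]) f (j + s) * (f j)^*.

(* The quotient is a real number, so taking its real part only changes its
   type from R[i] to R.  It is 0 when f = 0. *)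
Definition ADF (R : realType) (f : cseq R) : R :=
  complex.Re ((\sum_(s \in [set s : int | s != 0]) `|autocorr f s| ^+ 2)
              / autocorr f 0 ^+ 2).

(* Average over the finite set binary_seqs R l. *)
Definition expectation_seq (R : realType) (l : nat) (v : cseq R -> R) : R :=
  (\sum_(f \in binary_seqs R l) v f) / #|` fset_set (binary_seqs R l)|%:R.

Definition central_moment_seq (R : realType) (p l : nat)
    (v : cseq R -> R) : R :=
  expectation_seq l (fun f => (v f - expectation_seq l v) ^+ p).

(* If the variance is 0, division by zero gives the value 0 (for p > 0). *)
Definition std_moment_seq (R : realType) (p l : nat)
    (v : cseq R -> R) : R :=
  central_moment_seq p l v / (central_moment_seq 2 l v) `^ (p%:R / 2).

(* Main.v *)
(** The demerit factor is [ADF f = (N - l^2) / l^2], where [N] is the sum of all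
    squared autocorrelations, i.e. the sum of [x_a x_b x_c x_d] over [a + b = c + d].
    Since [x_i^2 = 1], it equals a constant plus [4 T], where [T] is the sum of
    [weight A] times the product of the [x_i], [i \in A], over the sets [A]:
    pairs of even sum have weight 1, quadruples [{a, b, c, d}] with [a + d = b + c]
    have weight 2.  Products over distinct sets being orthogonal, the moments of [T] are
    weighted counts of sets: [E T^2] is the sum of [weight^2], and [E T^3] is the sum
    of [weight (X :|: Y) * weight (X :|: Z) * weight (Y :|: Z)] over disjoint [X, Y, Z].
    The sizes of [X, Y, Z] can only be (up to order) 1,1,1 or 0,2,2 or 3,1,1 or 2,2,2,
    and in the last case the three pairs either all have the same sum or all have the
    same difference.  Each count is a sum of truncated linear functions, evaluated
    through its recurrence in [l]; the terms of period 3 in [l] cancel. *)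

Require Import Defs.
From mathcomp Require Import all_boot all_order all_algebra.
From mathcomp Require Import zify ring lra.

Set Implicit Arguments.
Unset Strict Implicit.
Unset Printing Implicit Defensive.
Import GRing.Theory.

(** * Sums over sets *)

Section SetSums.
Variable T : finType.
Implicit Types X Y Z A B : {set T}.

(** A product of the sign monomials of A, B and C has nonzero mean only if C is the symmetric
    difference of A and B. The three sets are then the pairwise unions of the Venn regions X = A ∩
    B, Y = A \ B and Z = B \ A. All weighted sets have 2 or 4 elements, which leaves only the listed
    sizes. The obstacle is disjointness. Distinct pairs with equal sum are automatically disjoint,
    so their configurations are counted by falling factorials of fibre sizes. Pairs with equal gap d
    may overlap in progressions of step d. Removing these overlaps by inclusion and exclusion
    produces sums of l - 2d and l - 3d, and sums of l - 4t when d = 2t. The last kind is the only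
    source of a dependence on l modulo 4 finer than parity. The sums of l - 3t arise in two
    contributions, with total coefficient 12 * (-4) + 8 * 6 = 0. Counts are stated in [nat] with
    denominators cleared and negative terms moved across, so that induction steps reduce to linear
    arithmetic in monomials. *)

Definition disj3 X Y Z := [&& [disjoint X & Y], [disjoint X & Z] & [disjoint Y & Z]].

(** [h] and [k] are mutually inverse between pairs of sets and disjoint triples; the fourth Venn
    region is the complement and carries no information. *)
Lemma sum_venn (F : {set T} -> {set T} -> {set T} -> nat) :
  \sum_A \sum_B F (A :&: B) (A :\: B) (B :\: A) =
  \sum_X \sum_Y \sum_(Z | disj3 X Y Z) F X Y Z.
Proof.
rewrite pair_bigA /=.
under [RHS]eq_bigr do rewrite pair_big_dep /=.
rewrite pair_big_dep /=.
pose h (p : {set T} * {set T}) :=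
  (p.1 :&: p.2, (p.1 :\: p.2, p.2 :\: p.1)).
pose k (q : {set T} * ({set T} * {set T})) := (q.1 :|: q.2.1, q.1 :|: q.2.2).
rewrite [RHS](reindex_onto h k) /=; last first.
  move=> [X [Y Z]] /= /and3P[]; rewrite -!setI_eq0 => /eqP/setP xy /eqP/setP xz /eqP/setP yz.
  congr (_, (_, _)); apply/setP => t; move: (xy t) (xz t) (yz t); rewrite !inE;
  by do 3![case: (t \in _)].
apply: eq_bigl => -[A B]; rewrite /h /k /disj3 -!setI_eq0 /=.
apply/esym/andP; split.
  by apply/and3P; split; apply/eqP/setP=> t; rewrite !inE; do 2![case: (t \in _)].
by apply/eqP; congr (_, _); apply/setP=> t; rewrite !inE; do 2![case: (t \in _)].
Qed.

Lemma sum_card1 (F : {set T} -> nat) :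
  \sum_(X : {set T} | #|X| == 1) F X = \sum_x F [set x].
Proof.
rewrite -(big_imset (h := set1) (A := T) F) /=; last by move=> x y _ _; apply: set1_inj.
by apply: eq_bigl => X; apply/cards1P/imsetP => [[x ->]|[x _ ->]]; exists x.
Qed.

End SetSums.

(** * Pairs, triples and quadruples of indices, and their weights *)

Section Ord.
Variable l : nat.
Local Notation I := 'I_l.
Implicit Types X Y Z A B : {set I}.

Definition asc (p : I * I) := p.1 < p.2.
Definition pset (p : I * I) : {set I} := [set p.1; p.2].

Lemma pset_inj : {in asc &, injective pset}.
Proof.
move=> [a b] [c d]; rewrite !unfold_in /asc /pset /= => ab cd /setP e.
have := e a; have := e b; have := e c; have := e d; rewrite !inE.
rewrite !eqxx !orbT /= -!val_eqE /= => *.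
by congr pair; apply: val_inj => /=; lia.
Qed.

Lemma card2_pset X : (#|X| == 2) = (X \in pset @: asc).
Proof.
apply/cards2P/imsetP => [[a [b [ne ->]]]|[[a b]]].
  case: (ltngtP a b) => [ab|ba|/val_inj e]; last by rewrite e eqxx in ne.
  - by exists (a, b).
  - by exists (b, a); rewrite // /pset setUC.
rewrite unfold_in /asc /= => ab ->; exists a, b; split=> //.
by apply: contraTneq ab => ->; rewrite ltnn.
Qed.

(** The operation is arbitrary because the lemma serves both for counts in [nat] and for sums of
    random signs. *)
Lemma sum_card2 (R : Type) (idx : R) (op : Monoid.com_law idx) (F : {set I} -> R) :
  \big[op/idx]_(X : {set I} | #|X| == 2) F X = \big[op/idx]_(p | asc p) F (pset p).
Proof.
rewrite -(big_imset (h := pset) (A := asc) F) /=; last exact: pset_inj.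
by apply: eq_bigl => X; rewrite card2_pset.
Qed.

Definition asc3 (t : I * I * I) := t.1.1 < t.1.2 < t.2.
Definition tset (t : I * I * I) : {set I} := [set t.1.1; t.1.2; t.2].

Lemma tset_inj : {in asc3 &, injective tset}.
Proof.
move=> [[a b] c] [[a' b'] c']; rewrite !unfold_in /asc3 /tset /= => abc abc' /setP e.
have := e a; have := e b; have := e c; have := e a'; have := e b'; have := e c'.
rewrite !inE !eqxx !orbT /= -!val_eqE /= => *.
by congr (_, _, _); apply: val_inj => /=; lia.
Qed.

Lemma card3_tset X : (#|X| == 3) = (X \in tset @: asc3).
Proof.
apply/idP/imsetP => [|[[[a b] c]]]; last first.
  rewrite unfold_in /asc3 /tset /= => abc ->; rewrite setUC cardsU1 cards2 !inE -!val_eqE /=; lia.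
move=> /eqP c3.
have /set0Pn[x xX] : X != set0 by rewrite -card_gt0 c3.
have : #|X :\ x| == 2 by rewrite (cardsD1 x) xX in c3; apply/eqP; lia.
rewrite card2_pset => /imsetP[[a b]]; rewrite unfold_in /asc /pset /= => ab /setP e.
have := e a; have := e b; have := e x; 
rewrite !inE !eqxx !orbT /= -!val_eqE /= => xab /andP[xb _] /andP[xa _].
have eX t : (t \in X) = [|| t == a, t == b | t == x].
  by have := e t; rewrite !inE; case: eqVneq => [->|_] /=; rewrite ?xX ?orbT ?orbF.
have [xla|alx] := ltnP x a.
  exists (x, a, b); first by rewrite unfold_in /asc3 /=; lia.
  by apply/setP=> t; rewrite eX !inE; do 3![case: eqP].
have [xlb|blx] := ltnP x b.
  exists (a, x, b); first by rewrite unfold_in /asc3 /=; lia.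
  by apply/setP=> t; rewrite eX !inE; do 3![case: eqP].
exists (a, b, x); first by rewrite unfold_in /asc3 /=; lia.
by apply/setP=> t; rewrite eX !inE; do 3![case: eqP].
Qed.

Lemma sum_card3 (F : {set I} -> nat) :
  \sum_(X : {set I} | #|X| == 3) F X = \sum_(t | asc3 t) F (tset t).
Proof.
rewrite -(big_imset (h := tset) (A := asc3) F) /=; last exact: tset_inj.
by apply: eq_bigl => X; rewrite card3_tset.
Qed.

Definition total (A : {set I}) : nat := \sum_(i in A) i.

(* The coefficients in [T] of a pair and of a quadruple: a splitting of [A] into two
   pairs of equal sum is counted twice, once for each half. *)
Definition weight2 A : nat := (#|A| == 2) && ~~ odd (total A).
Definition weight4 A : nat :=
  \sum_(X : {set I} | [&& X \subset A, #|X| == 2 & #|A :\: X| == 2])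
    (total X == total (A :\: X)).

Lemma total_pset (a b : I) : a != b -> total [set a; b] = a + b.
Proof. by move=> ab; rewrite /total big_setU1 ?inE // big_set1. Qed.

Lemma weight4_card A : weight4 A != 0 -> #|A| = 4.
Proof.
apply: contraNeq => cA; rewrite /weight4 big1 // => X /and3P[XA /eqP X2 /eqP AX].
by move: cA; rewrite -(cardsID X A) (setIidPr XA) X2 AX.
Qed.

Lemma weight2_card A : weight2 A != 0 -> #|A| = 2.
Proof. by rewrite /weight2; case: (#|A| =P 2). Qed.

Lemma weight2E (a b : I) : a != b -> weight2 [set a; b] = ~~ odd (a + b).
Proof. by move=> ab; rewrite /weight2 cards2 ab total_pset. Qed.

Lemma sum4 (F : I -> nat) (a b c d : I) : uniq [:: a; b; c; d] ->
  \sum_(i in [set a; b; c; d]) F i = F a + F b + F c + F d.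
Proof.
rewrite /= !inE !negb_or => /and4P[/and3P[ab ac ad] /andP[bc bd] cd _].
rewrite -!setUA !big_setU1 ?inE ?negb_or ?ab ?ac ?ad ?bc ?bd ?cd //= big_set1.
by rewrite !addnA.
Qed.

Lemma card4 (a b c d : I) : uniq [:: a; b; c; d] -> #|[set a; b; c; d]| = 4.
Proof. by move=> u; rewrite -sum1_card sum4. Qed.

Lemma sum_pairs4 (F : I -> I -> nat) (a b c d : I) : uniq [:: a; b; c; d] ->
  (forall i j, F i j = F j i) ->
  \sum_(p | asc p && (pset p \subset [set a; b; c; d])) F p.1 p.2 =
  F a b + F a c + F a d + F b c + F b d + F c d.
Proof.
move=> u sF; set A := [set a; b; c; d].
transitivity (\sum_(i in A) \sum_(j in A) (i < j) * F i j).
  rewrite pair_big_dep /= big_mkcond [RHS]big_mkcond /=; apply: eq_bigr => -[i j] _ /=.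
  rewrite subUset !sub1set /asc /=.
  by case: (i < j); case: (i \in A); case: (j \in A); rewrite ?mul1n ?mul0n.
under eq_bigr do rewrite /A sum4 //.
rewrite sum4 // !ltnn.
(* For two distinct elements exactly one of the two orders is increasing, and symmetry of [F] makes
   the choice immaterial. *)
have E i j : i != j :> I -> (i < j) * F i j + (j < i) * F j i = F i j.
  by rewrite -val_eqE (sF j i) -mulnDl /= => ij; case: ltngtP ij => //; rewrite mul1n.
move: u; rewrite /= !inE !negb_or => /and4P[/and3P[ab ac ad] /andP[bc bd] cd _].
rewrite -(E a b) // -(E a c) // -(E a d) // -(E b c) // -(E b d) // -(E c d) //.
by rewrite !mul0n; lia.
Qed.

(** Equality of the two half sums is equivalent to [2 * total X = total A], a condition that no
    longer mentions the complement of X. *)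
Lemma weight4_pairs A : #|A| = 4 ->
  weight4 A = \sum_(p | asc p && (pset p \subset A)) (2 * (p.1 + p.2) == total A).
Proof.
move=> cA; transitivity
  (\sum_(X : {set I} | #|X| == 2) ((X \subset A) && (2 * total X == total A))).
  rewrite /weight4 big_mkcond [RHS]big_mkcond; apply: eq_bigr => X _.
  case: (boolP (X \subset A)) => XA /=; last by case: ifP.
  case: eqP => cX //=.
  have -> : #|A :\: X| == 2 by rewrite cardsD (setIidPr XA) cX cA.
  have -> : total A = total X + total (A :\: X).
    by rewrite /total [LHS](big_setID X) /= (setIidPr XA).
  by congr nat_of_bool; apply/eqP/eqP; lia.
rewrite sum_card2 big_mkcondr /=; apply: eq_bigr => p pp.
have ? : p.1 != p.2 by rewrite -val_eqE /=; rewrite /asc in pp; lia.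
by rewrite /pset total_pset //; case: ifP.
Qed.

(** A 4-set has three splittings into two pairs; each balanced one is found from either half, whence
    the factor 2. *)
Lemma weight4E (a b c d : I) : uniq [:: a; b; c; d] ->
  weight4 [set a; b; c; d] =
  2 * ((a + b == c + d) + (a + c == b + d) + (a + d == b + c)).
Proof.
move=> u; rewrite weight4_pairs ?card4 // /total sum4 //.
rewrite (sum_pairs4 (F := fun i j => 2 * (i + j) == a + b + c + d)) //; last first.
  by move=> i j; rewrite (addnC i).
have E m n k : n = m + k -> (2 * m == n) = (m == k) by move=> ->; lia.
rewrite (E _ _ (c + d)) 1?(E _ _ (b + d)) 1?(E _ _ (b + c))
  1?(E _ _ (a + d)) 1?(E _ _ (a + c)) 1?(E _ _ (a + b)); lia.
Qed.

End Ord.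

(** * Triple sums over sets, and tuples of distinct elements in a fibre *)

Section Generic.
Variable T : finType.
Implicit Types X Y Z A B : {set T}.

Lemma big_condM (P Q : pred T) (F : T -> nat) :
  \sum_(x | P x && Q x) F x = \sum_(x | P x) Q x * F x.
Proof.
by rewrite big_mkcondr; apply: eq_bigr => x _; case: (Q x); rewrite ?mul1n ?mul0n.
Qed.

Lemma sum_split_set (V : nmodType) (F : {set T} -> {set T} -> V) :
  (\sum_(A : {set T}) \sum_(X : {set T} | X \subset A) F X (A :\: X) =
   \sum_(X : {set T}) \sum_(Y : {set T} | [disjoint X & Y]) F X Y)%R.
Proof.
rewrite (exchange_big_dep xpredT) //=; apply: eq_bigr => X _.
rewrite (reindex_onto (fun Y => X :|: Y) (fun A => A :\: X)) /=; last first.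
  by move=> A XA; rewrite setDE setUIr setUCr setIT; apply/setUidPr.
apply: eq_big => [Y|Y].
  rewrite subsetUl /= setDUl setDv set0U -setI_eq0.
  apply/eqP/eqP => [/setDidPl|e]; first by rewrite -setI_eq0 setIC => /eqP.
  by apply/setDidPl; rewrite -setI_eq0 setIC e.
by case/andP=> _ /eqP ->.
Qed.

Definition symdiff A B := (A :\: B) :|: (B :\: A).

Lemma symdiffC A B : symdiff A B = symdiff B A.
Proof. exact: setUC. Qed.

Lemma symdiffK A : involutive (symdiff A).
Proof. by move=> B; apply/setP=> x; rewrite !inE; do 2!case: (_ \in _). Qed.

(* Third moment: products of signs multiply by symmetric difference, and only the
   empty product has a nonzero mean. *)
Definition triple_sum (u v w : {set T} -> nat) := \sum_A \sum_B u A * v B * w (symdiff A B).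

Lemma triple_sum_venn u v w :
  triple_sum u v w = \sum_X \sum_Y \sum_(Z | disj3 X Y Z) u (X :|: Y) * v (X :|: Z) * w (Y :|: Z).
Proof.
rewrite -sum_venn; apply: eq_bigr => A _; apply: eq_bigr => B _.
by rewrite setID (setIC A) setID.
Qed.

(** For disjoint sets the sizes of the three pairwise unions form an invertible linear system in the
    sizes of X, Y, Z. Disjointness becomes a factor so that each set can then be reindexed on its
    own. *)
Lemma triple_sum_sized u v w (a b c : nat) :
    (forall A, u A != 0 -> #|A| = a + b) -> (forall A, v A != 0 -> #|A| = a + c) ->
    (forall A, w A != 0 -> #|A| = b + c) ->
  triple_sum u v w = \sum_(X : {set T} | #|X| == a) \sum_(Y : {set T} | #|Y| == b)
    \sum_(Z : {set T} | #|Z| == c)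
      disj3 X Y Z * (u (X :|: Y) * v (X :|: Z) * w (Y :|: Z)).
Proof.
move=> hu hv hw; rewrite triple_sum_venn.
have key X Y Z : disj3 X Y Z -> u (X :|: Y) * v (X :|: Z) * w (Y :|: Z) != 0 ->
    [/\ #|X| = a, #|Y| = b & #|Z| = c].
  move=> /and3P[]; rewrite -!leq_card_setU => /eqP xy /eqP xz /eqP yz.
  rewrite !muln_eq0 !negb_or => /andP[/andP[/hu + /hv +] /hw].
  by rewrite xy xz yz => *; split; lia.
rewrite [RHS]big_mkcond; apply: eq_bigr => X _; case: eqP => cX; last first.
  rewrite big1 // => Y _; rewrite big1 // => Z d.
  by apply/eqP; apply: contraT => /(key _ _ _ d)[].
rewrite [RHS]big_mkcond; apply: eq_bigr => Y _; case: eqP => cY; last first.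
  by rewrite big1 // => Z d; apply/eqP; apply: contraT => /(key _ _ _ d)[].
rewrite big_mkcond [RHS]big_mkcond; apply: eq_bigr => Z _.
case: ifP => d; case: eqP => cZ; rewrite ?mul1n ?mul0n //.
by apply/eqP; apply: contraT => /(key _ _ _ d)[].
Qed.

Lemma triple_sumC u v w : triple_sum u v w = triple_sum v u w.
Proof.
rewrite /triple_sum exchange_big; apply: eq_bigr => B _; apply: eq_bigr => A _.
by rewrite symdiffC (mulnC (u _)).
Qed.

(** The involution sending B to the symmetric difference of A and B exchanges the last two
    arguments. *)
Lemma triple_sumAC u v w : triple_sum u v w = triple_sum u w v.
Proof.
rewrite /triple_sum; apply: eq_bigr => A _; rewrite (reindex_inj (inv_inj (symdiffK A))).
by apply: eq_bigr => B _; rewrite symdiffK mulnAC.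
Qed.

(** A triple sum is symmetric in its three functions, so the eight terms of the expansion group with
    multiplicities 1, 3, 3, 1. *)
Lemma triple_sumD u v (s := fun A => u A + v A) : triple_sum s s s =
  triple_sum u u u + 3 * triple_sum u u v + 3 * triple_sum v v u + triple_sum v v v.
Proof.
have -> : 3 * triple_sum u u v = triple_sum u u v + triple_sum u v u + triple_sum v u u.
  by rewrite (triple_sumC v u) (triple_sumAC u v u); lia.
have -> : 3 * triple_sum v v u = triple_sum v v u + triple_sum v u v + triple_sum u v v.
  by rewrite (triple_sumC u v) (triple_sumAC v u v); lia.
rewrite {}/s /triple_sum -!big_split /=; apply: eq_bigr => A _.
by rewrite -!big_split /=; apply: eq_bigr => B _; ring.
Qed.

Lemma card_distinct2 (K : pred T) : \sum_(x | K x) \sum_(y | K y && (y != x)) 1 = #|K| ^_ 2.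
Proof.
under eq_bigr => x Kx.
  rewrite (_ : (\sum_(y | _) 1) = #|K|.-1); last first.
    by rewrite -[in RHS]sum1_card [in RHS](bigD1 x).
  over.
by rewrite sum_nat_const ffactnS ffactn1.
Qed.

Lemma card_distinct3 (K : pred T) :
  \sum_(x | K x) \sum_(y | K y && (y != x)) \sum_(z | [&& K z, z != x & z != y]) 1 = #|K| ^_ 3.
Proof.
under eq_bigr => x Kx.
  under eq_bigr => y /andP[Ky yx].
    rewrite (_ : (\sum_(z | _) 1) = #|K|.-2); last first.
      rewrite -[in RHS]sum1_card [in RHS](bigD1 x) //= [in RHS](bigD1 y) /=; last by apply/andP.
      by apply: eq_bigl => z; rewrite andbA.
    over.
  rewrite sum_nat_cond_const.
  rewrite (_ : #|_| = #|K|.-1); last first.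
    rewrite -!sum1_card [in RHS](bigD1 x) //=.
    by apply: eq_bigl => y; rewrite inE.
  over.
by rewrite sum_nat_const !ffactnS ffactn0 muln1.
Qed.

Lemma sum_by_value (D : pred T) (h : T -> nat) n (F : T -> nat) :
  (forall x, D x -> h x < n) ->
  \sum_(x | D x) F x = \sum_(s < n) \sum_(x | D x && (h x == s)) F x.
Proof.
move=> hn; rewrite (exchange_big_dep D) /=; last by move=> i x _ /andP[].
apply: eq_bigr => x Dx; rewrite (big_pred1 (Ordinal (hn x Dx))) // => s.
by rewrite Dx /= -val_eqE eq_sym.
Qed.

(** Classified by the common value s, the pairs are ordered pairs of distinct elements of one fibre,
    hence a falling factorial. *)
Lemma sum_fibre2 (D : pred T) (h : T -> nat) n (c : pred nat) : (forall x, D x -> h x < n) ->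
  \sum_(x | D x) \sum_(y | D y && (y != x)) (c (h x) && (h x == h y)) =
  \sum_(s < n | c s) #|[pred x | D x & h x == s]| ^_ 2.
Proof.
move=> hn; rewrite (sum_by_value _ hn) [RHS]big_mkcond; apply: eq_bigr => s _.
case: ifP => cs; last first.
  by rewrite big1 // => x /andP[_ /eqP ->]; rewrite big1 // cs.
rewrite -card_distinct2; apply: eq_bigr => x /andP[Dx /eqP hx].
rewrite big_mkcond [RHS]big_mkcond; apply: eq_bigr => y _ /=.
by rewrite hx cs (eq_sym (h y)); case: (D y); case: (_ == h y); case: (y != x).
Qed.

Lemma sum_fibre3 (D : pred T) (h : T -> nat) n : (forall x, D x -> h x < n) ->
  \sum_(x | D x) \sum_(y | D y && (y != x)) \sum_(z | [&& D z, z != x & z != y])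
    ((h x == h y) && (h x == h z)) =
  \sum_(s < n) #|[pred x | D x & h x == s]| ^_ 3.
Proof.
move=> hn; rewrite (sum_by_value _ hn); apply: eq_bigr => s _.
rewrite -card_distinct3; apply: eq_bigr => x /andP[Dx /eqP hx].
rewrite big_mkcond [RHS]big_mkcond; apply: eq_bigr => y _ /=.
rewrite hx (eq_sym (h y)); case: (D y); case: (y != x) => //=; rewrite ?andbF ?if_same //.
case: eqP => hy; last by rewrite big1.
rewrite big_mkcond [RHS]big_mkcond; apply: eq_bigr => z _ /=.
by rewrite (eq_sym (h z)); case: (D z); case: (_ == h z); do 2!case: (z == _).
Qed.

End Generic.

(** * The contributions to the third moment *)

Section Counts.
Variable l : nat.
Local Notation I := 'I_l.
Implicit Types (X Y Z A B : {set I}) (p q r : I * I).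

Definition psum p : nat := p.1 + p.2.
Definition gap p : nat := p.2 - p.1.
Definition apart p q := [&& p.1 != q.1, p.1 != q.2, p.2 != q.1 & p.2 != q.2].

Lemma asc_neq p : asc p -> p.1 != p.2.
Proof. by rewrite /asc -val_eqE /= => ?; lia. Qed.

Lemma disj_pset p q : [disjoint pset p & pset q] = apart p q.
Proof.
by rewrite /pset disjoints_subset subUset !sub1set !inE !negb_or andbA -!andbA.
Qed.

(** With a < b and c < d, the splitting a + c = b + d is impossible, and a + d = b + c says that the
    gaps agree. *)
Lemma weight4_pset p q : asc p -> asc q -> apart p q ->
  weight4 (pset p :|: pset q) = 2 * ((psum p == psum q) + (gap p == gap q)).
Proof.
case: p q => [a b] [c d]; rewrite /asc /apart /= => ab cd /and4P[ac ad bc bd].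
rewrite /pset setUA weight4E /=; last first.
  rewrite !inE !negb_or ac ad bc bd (asc_neq (p := (a, b))) ?(asc_neq (p := (c, d))) //.
by rewrite /psum /gap /=; lia.
Qed.

(** Two pairs with the same sum that share one element share the other as well. *)
Lemma apart_neq p q : asc p -> asc q -> psum p == psum q -> apart p q = (q != p).
Proof.
case: p q => [a b] [c d]; rewrite /asc /apart /psum /= xpair_eqE -!val_eqE /=; lia.
Qed.

(** Sum and gap together determine a pair, and a pair is not disjoint from itself. *)
Lemma psum_gap_neq p q : asc p -> asc q -> apart p q -> psum p == psum q -> gap p == gap q -> False.
Proof.
case: p q => [a b] [c d]; rewrite /asc /apart /psum /gap /= -!val_eqE /=; lia.
Qed.

(* Two disjoint pairs whose union is an additive quadruple share their sum or their
   gap but not both, so two equal labels in a triangle of pairs force the third. *)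
Lemma prod_edge_labels (s1 s2 s3 d1 d2 d3 : nat) :
  (s1 == s2 -> d1 == d2 -> False) -> (s1 == s3 -> d1 == d3 -> False) ->
  (s2 == s3 -> d2 == d3 -> False) ->
  2 * ((s1 == s2) + (d1 == d2)) * (2 * ((s1 == s3) + (d1 == d3))) *
    (2 * ((s2 == s3) + (d2 == d3))) =
  8 * ((s1 == s2) && (s1 == s3)) + 8 * ((d1 == d2) && (d1 == d3)).
Proof.
have [<-|/negbTE n12] := eqVneq s1 s2.
  have [_ []//|/negbTE m12 _] := eqVneq d1 d2.
  have [_|_] := eqVneq s1 s3; have [e|_] := eqVneq d1 d3 => //=.
  - by case.
  - by have [_ _ []|] := eqVneq d2 d3.
  - by rewrite -e (eq_sym d2) m12 muln0.
have [<-|/negbTE m12] := eqVneq d1 d2; last by rewrite muln0.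
have [<-|_] := eqVneq s1 s3; rewrite ?(eq_sym s2) ?n12.
  by have [_ _ []|_] := eqVneq d1 d3; rewrite ?muln0.
have [_|_] := eqVneq s2 s3.
  by have [_ _ _ []|_] := eqVneq d1 d3; rewrite ?muln0.
by case: (_ == _).
Qed.

Lemma triple_sum_444 : triple_sum (@weight4 l) (@weight4 l) (@weight4 l) =
  8 * (\sum_(p | asc p) \sum_(q | asc q && (q != p)) \sum_(r | [&& asc r, r != p & r != q])
         ((psum p == psum q) && (psum p == psum r))
     + \sum_(p | asc p) \sum_(q | asc q && apart p q) \sum_(r | [&& asc r, apart p r & apart q r])
         ((gap p == gap q) && (gap p == gap r))).
Proof.
rewrite (@triple_sum_sized _ _ _ _ 2 2 2); [|exact: weight4_card..].
rewrite sum_card2 mulnDr !big_distrr /= -big_split; apply: eq_bigr => p pp /=.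
rewrite sum_card2 !big_condM !big_distrr /= -big_split; apply: eq_bigr => q pq /=.
rewrite sum_card2 !big_condM !big_distrr /= -big_split; apply: eq_bigr => r pr /=.
(* If two of the pairs meet, the gap sum excludes the triple explicitly. The sum over equal sums
   excludes it too, because there distinctness already forces disjointness. *)
have [/and3P[apq apr aqr]|na] := boolP [&& apart p q, apart p r & apart q r]; last first.
  rewrite /disj3 !disj_pset (negbTE na) mul0n.
  rewrite [X in _ = _ + X](_ : _ = 0); last by move: na; do 3!case: (apart _ _).
  have [|_] := boolP (psum p == psum q); last by rewrite !muln0.
  have [|_] := boolP (psum p == psum r); last by rewrite !muln0.
  move=> spr spq; have sqr : psum q == psum r by rewrite -(eqP spq).
  by move: na; rewrite !apart_neq //; do 3!case: (_ != _).
rewrite /disj3 !disj_pset apq apr aqr !weight4_pset // !mul1n.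
have npq : q != p by apply: contraTneq apq => ->; rewrite /apart eqxx.
have npr : r != p by apply: contraTneq apr => ->; rewrite /apart eqxx.
have nqr : r != q by apply: contraTneq aqr => ->; rewrite /apart eqxx.
rewrite npq npr nqr !mul1n.
by apply: prod_edge_labels; apply: psum_gap_neq.
Qed.

Definition pair_sum_count (s : nat) := #|[pred p : I * I | asc p & psum p == s]|.

(** Here the region X is empty. The sum and the gap of a pair have the same parity, so for equal
    gaps a single parity condition makes both pairs even. *)
Lemma triple_sum_224 : triple_sum (@weight2 l) (@weight2 l) (@weight4 l) =
  2 * (\sum_(s < l.*2 | ~~ odd s) pair_sum_count s ^_ 2
     + \sum_(p | asc p) \sum_(q | asc q && apart p q) (~~ odd (gap p) && (gap p == gap q))).
Proof.
rewrite (@triple_sum_sized _ _ _ _ 0 2 2); [|exact: weight2_card|exact: weight2_card|exact: weight4_card].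
rewrite (big_pred1 set0) => [|X]; last by rewrite cards_eq0.
rewrite -(sum_fibre2 (D := @asc l) (h := psum) (n := l.*2) (fun s => ~~ odd s)); last first.
  by move=> [a b] _; rewrite /psum /=; have := ltn_ord a; have := ltn_ord b; lia.
rewrite sum_card2 mulnDr !big_distrr /= -big_split; apply: eq_bigr => p pp /=.
rewrite sum_card2 !big_condM !big_distrr /= -big_split; apply: eq_bigr => q pq /=.
rewrite /disj3 -!setI_eq0 !set0I !eqxx setI_eq0 !set0U disj_pset !weight2E ?asc_neq //=.
have [a|na] := boolP (apart p q); last first.
  rewrite mul0n addn0; have [e|_] := boolP (psum p == psum q); last by rewrite andbF !muln0.
  by move: na; rewrite apart_neq // => /negbTE->.
have npq : q != p by apply: contraTneq a => ->; rewrite /apart eqxx.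
rewrite weight4_pset // npq !mul1n.
case: p q pp pq {a npq} => [a b] [c d]; rewrite /asc /psum /gap /=; lia.
Qed.
Lemma sum_ord_eq (n : nat) : \sum_(y < l) (y == n :> nat) = (n < l).
Proof.
have [nl|ln] := ltnP n l.
  rewrite (bigD1 (Ordinal nl)) //= eqxx big1 ?addn0 // => y.
  by rewrite -val_eqE /= => /negbTE->.
by rewrite big1 // => y _; have := ltn_ord y; lia.
Qed.

(* Number of ways to complete a triple to an additive quadruple: the new element lies
   below, between or above the given ones. *)
Definition completions (t : I * I * I) : nat :=
  (t.2 <= t.1.1 + t.1.2) + (t.1.1 + t.2 != t.1.2.*2) + (t.1.2 + t.2 < l + t.1.1).

Definition completes (t : I * I * I) (y : I) : bool :=
  (y \notin tset t) && [|| y + t.2 == t.1.1 + t.1.2, y + t.1.2 == t.1.1 + t.2 |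
    y + t.1.1 == t.1.2 + t.2].

Lemma notin_tset (t : I * I * I) (y : I) :
  (y \notin tset t) = [&& y != t.1.1 :> nat, y != t.1.2 :> nat & y != t.2 :> nat].
Proof. by rewrite /tset !inE !negb_or -!val_eqE /= -andbA. Qed.

Lemma card_completes t : asc3 t -> #|completes t| = completions t.
Proof.
case: t => [[p q] r]; rewrite /asc3 /= => /andP[pq qr].
have sum_eq m n : \sum_(y < l) (y + m == n) = (m <= n < l + m).
  transitivity ((m <= n) * \sum_(y < l) (y == n - m :> nat)).
    rewrite big_distrr; apply: eq_bigr => y _ /=.
    by case: leqP => mn; rewrite ?mul1n ?mul0n; case: eqP => ?; first [lia|case: eqP => ?; lia].
  by rewrite sum_ord_eq; case: leqP => mn; rewrite ?mul1n ?mul0n //=; lia.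
rewrite -sum1_card big_mkcond /=.
(* For p < q < r the three solutions lie below p, strictly between p and r, and above r. They are
   therefore distinct, and only the middle one can hit the triple, namely at q when p + r = 2q. *)
transitivity (\sum_(y < l) ((y + r == p + q) + (p + r != q.*2) * (y + q == p + r) +
    (y + p == q + r))).
  apply: eq_bigr => y _; rewrite unfold_in /completes notin_tset /= (eq_sym (p + r)).
  case: (_ =P p + q) => e1; case: (_ =P p + r) => e2; case: (_ =P q + r) => e3;
  do ?[case: eqP => ? /=]; lia.
rewrite !big_split /= -!big_distrr /= !sum_eq /completions /=.
have := ltn_ord r => rl; congr (_ + _ + _); first by congr nat_of_bool; lia.
- by case: eqP => ?; rewrite ?mul0n ?mul1n //; lia.
- by congr nat_of_bool; lia.
Qed.

Lemma weight4_tset t (y : I) : asc3 t -> y \notin tset t ->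
  weight4 (tset t :|: [set y]) = 2 * completes t y.
Proof.
move=> at3 yt; rewrite /completes yt /=.
move: yt; rewrite notin_tset; case: t at3 => [[p q] r]; rewrite /asc3 /tset /= => at3 ny.
rewrite weight4E /=; last by rewrite !inE !negb_or -!val_eqE /=; lia.
rewrite [y + r]addnC [y + q]addnC [y + p]addnC (eq_sym (r + y)) (eq_sym (q + y)).
by congr (2 * _); do 3!case: eqP => ?; lia.
Qed.

Lemma disj3_set1 X (y z : I) :
  disj3 X [set y] [set z] = [&& y \notin X, z \notin X & y != z].
Proof.
by rewrite /disj3 disjoint_sym disjoints1 (disjoint_sym X) !disjoints1 inE.
Qed.

(** The triple is completed independently by two distinct elements. Each completion has the parity
    of the sum of the triple, so the pair of completions automatically has weight 1. *)
Lemma triple_sum_442 : triple_sum (@weight4 l) (@weight4 l) (@weight2 l) =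
  4 * (\sum_(t | asc3 t) completions t ^_ 2).
Proof.
rewrite (@triple_sum_sized _ _ _ _ 3 1 1); [|exact: weight4_card|exact: weight4_card|exact: weight2_card].
rewrite sum_card3 !big_distrr /=; apply: eq_bigr => t at3.
rewrite -card_completes // -card_distinct2 sum_card1 big_distrr [RHS]big_mkcond.
apply: eq_bigr => y _ /=; rewrite sum_card1.
have [yt|yt] := boolP (y \in tset t).
  by rewrite big1 ?/completes ?yt // => z _; rewrite disj3_set1 yt /= mul0n.
case: ifP => ct; last first.
  by rewrite big1 // => z _; rewrite weight4_tset // ct !muln0.
rewrite big_distrr [RHS]big_mkcond; apply: eq_bigr => z _; rewrite disj3_set1 yt.
have [zt|zt] := boolP (z \in tset t); first by rewrite /completes zt /= mul0n.
rewrite !weight4_tset // ct (eq_sym y); case: (boolP (completes t z)) => cz; rewrite ?muln0 //.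
have [//|zy] := eqVneq z y.
rewrite weight2E 1?eq_sym //=; suff -> : odd (y + z) = false by [].
move: ct cz; rewrite /completes yt zt /=; lia.
Qed.

(** Pairwise even sums mean that the three elements lie in one parity class. *)
Lemma triple_sum_222 : triple_sum (@weight2 l) (@weight2 l) (@weight2 l) =
  \sum_(s < 2) #|[pred x : I | odd x == s :> nat]| ^_ 3.
Proof.
rewrite (@triple_sum_sized _ _ _ _ 1 1 1); [|exact: weight2_card..].
transitivity (\sum_(s < 2) #|[pred x : I | true & odd x == s :> nat]| ^_ 3); last by [].
rewrite -(sum_fibre3 (D := predT) (h := fun x : I => odd x : nat)); last by move=> x _; case: odd.
rewrite sum_card1; apply: eq_bigr => x _.
rewrite sum_card1 [RHS]big_mkcond; apply: eq_bigr => y _ /=.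
rewrite sum_card1.
have [->|nxy] := eqVneq x y.
  by rewrite big1 // => z _; rewrite disj3_set1 inE eqxx mul0n.
rewrite [RHS]big_mkcond; apply: eq_bigr => z _ /=.
rewrite disj3_set1 !inE (eq_sym y x) nxy /=.
have [->|nxz] := eqVneq x z; first by rewrite mul0n.
have [->|nyz] := eqVneq y z; first by rewrite mul0n.
by rewrite !weight2E // !oddD; do 3!case: odd.
Qed.

Lemma sum_weight2 : \sum_(A : {set I}) weight2 A = \sum_(s < l.*2 | ~~ odd s) pair_sum_count s.
Proof.
transitivity (\sum_(A : {set I} | #|A| == 2) weight2 A).
  by rewrite [RHS]big_mkcond; apply: eq_bigr => A _; rewrite /weight2; case: eqP.
rewrite sum_card2 (sum_by_value (h := psum) (n := l.*2)); last first.
  by move=> [a b] _; rewrite /psum /=; have := ltn_ord a; have := ltn_ord b; lia.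
rewrite [RHS]big_mkcond; apply: eq_bigr => s _.
transitivity (\sum_(p | asc p && (psum p == s)) ~~ odd s).
  by apply: eq_bigr => p /andP[pp /eqP <-]; rewrite weight2E ?asc_neq.
by rewrite sum_nat_const; case: odd; rewrite ?muln0 ?muln1.
Qed.

Lemma setU_subD X A : X \subset A -> X :|: A :\: X = A.
Proof. by move=> XA; rewrite -{1}(setIidPr XA) setID. Qed.

(** The value [x] is left general: constant 1 gives the count of weighted quadruples, and a sign
    monomial gives the quadruple part of the energy. *)
Lemma sum_weight4_join (V : nmodType) (x : {set I} -> V) :
  (\sum_(A : {set I}) x A *+ weight4 A =
  \sum_(p | asc p) \sum_(q | asc q && (q != p)) x (pset p :|: pset q) *+ (psum p == psum q))%R.
Proof.
pose F (X Y : {set I}) : V := (if ((#|X| == 2) && (#|Y| == 2))%N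
  then x (X :|: Y) *+ (total X == total Y) else 0)%R.
transitivity (\sum_(A : {set I}) \sum_(X : {set I} | X \subset A) F X (A :\: X))%R.
  apply: eq_bigr => A _; rewrite /weight4 -sumrMnr big_mkcondr; apply: eq_bigr => X XA /=.
  by rewrite /F setU_subD.
rewrite (sum_split_set F)
 (bigID (fun X : {set I} => #|X| == 2)) /= addrC big1 => [|X /negbTE nX].
  rewrite add0r sum_card2; apply: eq_bigr => p pp.
  rewrite (bigID (fun X : {set I} => #|X| == 2)) /= addrC big1 => [|Y /andP[_ /negbTE nY]].
    rewrite add0r; under eq_bigl do rewrite andbC.
    rewrite big_mkcondr /= sum_card2 [RHS]big_mkcondr /=.
    apply: eq_bigr => q pq.
    rewrite disj_pset /F card2_pset imset_f // card2_pset imset_f //= /pset !total_pset ?asc_neq //.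
    rewrite -!/(pset _) -!/(psum _); have [e|_] := boolP (psum p == psum q).
      by rewrite (apart_neq pp pq e).
    by rewrite mulr0n !if_same.
  by rewrite /F nY andbF.
by rewrite big1 // => Y _; rewrite /F nX.
Qed.

(** The weight is 0 or 2, since a 4-set has at most one balanced splitting: the two halves of one
    splitting cannot also share their gap. *)
Lemma weight4_sq A : weight4 A ^ 2 = 2 * weight4 A.
Proof.
have [->//|] := eqVneq (weight4 A) 0.
rewrite {1}/weight4 sum_nat_eq0 negb_forall => /existsP[X].
rewrite negb_imply => /andP[/and3P[XA]]; rewrite !card2_pset.
move=> /imsetP[p pp eX] /imsetP[q pq eY] _.
have eA : A = pset p :|: pset q by rewrite -eX -eY setU_subD.
have apq : apart p q.
  rewrite -disj_pset -eX -eY -setI_eq0; apply/eqP/setP=> t.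
  by rewrite !inE; case: (t \in X).
rewrite eA weight4_pset //; case: eqP => [/eqP e|_]; case: eqP => // /eqP d.
by case: (psum_gap_neq pp pq apq e d).
Qed.

Lemma sum_weight4 : \sum_(A : {set I}) weight4 A = \sum_(s < l.*2) pair_sum_count s ^_ 2.
Proof.
rewrite -(sum_fibre2 (D := @asc l) (h := psum) (n := l.*2) xpredT); last first.
  by move=> [a b] _; rewrite /psum /=; have := ltn_ord a; have := ltn_ord b; lia.
transitivity (\sum_(A : {set I}) (1 *+ weight4 A : nat))%R.
  by apply: eq_bigr => A _; rewrite natn.
etransitivity; first exact: sum_weight4_join.
by apply: eq_bigr => p _; apply: eq_bigr => q _; rewrite natn.
Qed.

Lemma weight2_weight4 A : weight2 A * weight4 A = 0.
Proof.
have [->|/weight2_card c2] := eqVneq (weight2 A) 0; first by [].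
by have [->|/weight4_card] := eqVneq (weight4 A) 0; rewrite ?muln0 // c2.
Qed.

Lemma sum_weight_sq : \sum_(A : {set I}) (weight2 A + weight4 A) ^ 2 =
  \sum_(s < l.*2 | ~~ odd s) pair_sum_count s + 2 * \sum_(s < l.*2) pair_sum_count s ^_ 2.
Proof.
under eq_bigr do rewrite sqrnD weight2_weight4 muln0 addn0 weight4_sq.
rewrite big_split -big_distrr sum_weight4 /=; congr (_ + _); rewrite -sum_weight2.
by apply: eq_bigr => A _; rewrite /weight2; case: (_ && _).
Qed.

End Counts.

(** * Evaluation of the counts *)

Lemma sum_ord_trunc (f : nat -> nat) m n : m <= n -> (forall i, m <= i -> f i = 0) ->
  \sum_(i < n) f i = \sum_(i < m) f i.
Proof.
move=> mn f0; rewrite (big_ord_widen _ f mn) [RHS]big_mkcond /=.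
by apply: eq_bigr => i _; case: ltnP => // /f0.
Qed.

Lemma sum_ord_gt (l p : nat) (f : nat -> nat) :
  \sum_(q < l | p < q) f q = \sum_(u < l | p + u.+1 < l) f (p + u.+1).
Proof.
have [lp|] := ltnP p l; last first.
  by move=> lp; rewrite !big1 // => u; have := ltn_ord u; lia.
rewrite -(subnKC lp) big_split_ord /= big1 => [|q]; last by have := ltn_ord q; lia.
rewrite add0n; under eq_bigl do rewrite leq_addr.
rewrite (big_ord_widen _ (fun i => f (p.+1 + i)) (leq_addl p.+1 _)).
by apply: eq_big => [u|u _]; [lia | congr f; lia].
Qed.

(* The subtractions are truncated, so these sums only see the positive terms. *)
Definition sum_lin k l := \sum_(v < l) (l - k * v.+1).
Definition sum_lin2 j k l := \sum_(u < l) \sum_(v < l) (l - j * u.+1 - k * v.+1).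

(** Raising l by k shifts the summands by one place: v = 0 supplies the new term l, and the surplus
    terms at the end are truncated to 0. *)
Lemma sum_lin_rec k l : 0 < k -> sum_lin k (l + k) = l + sum_lin k l.
Proof.
case: k => // k _; rewrite /sum_lin addnS big_ord_recl; congr (_ + _); first by rewrite muln1; lia.
rewrite (sum_ord_trunc (f := fun v => (l + k).+1 - k.+1 * (bump 0 v).+1) (m := l)); first last.
- by move=> i li; rewrite /bump /=; nia.
- by lia.
by apply: eq_bigr => i _; rewrite /bump /=; nia.
Qed.

Lemma sum_lin2_rec j k l : 0 < j -> 0 < k -> sum_lin2 j k (l + j) = sum_lin k l + sum_lin2 j k l.
Proof.
case: j => // j _ k0; rewrite /sum_lin2 /sum_lin addnS big_ord_recl; congr (_ + _).
  rewrite (sum_ord_trunc (f := fun v => (l + j).+1 - j.+1 * 1 - k * v.+1) (m := l)); first last.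
  - by move=> i li; nia.
  - by lia.
  by apply: eq_bigr => v _; nia.
have E u : \sum_(v < (l + j).+1) ((l + j).+1 - j.+1 * (bump 0 u).+1 - k * v.+1) =
    \sum_(v < l) (l - j.+1 * u.+1 - k * v.+1).
  rewrite (sum_ord_trunc (f := fun v => (l + j).+1 - j.+1 * (bump 0 u).+1 - k * v.+1) (m := l)); first last.
  - by move=> i li; rewrite /bump /=; nia.
  - by lia.
  by apply: eq_bigr => i _; rewrite /bump /=; nia.
under eq_bigr do rewrite E.
apply: (sum_ord_trunc (f := fun u => \sum_(v < l) (l - j.+1 * u.+1 - k * v.+1))) => [|i li]; first by lia.
by rewrite big1 // => v _; nia.
Qed.

Lemma sum_lin2C j k l : sum_lin2 j k l = sum_lin2 k j l.
Proof.
rewrite /sum_lin2 exchange_big; apply: eq_bigr => u _; apply: eq_bigr => v _.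
by rewrite -!subnDA addnC.
Qed.

Section Reindex.
Variable l : nat.

Lemma sum_asc (F : nat -> nat -> nat) :
  \sum_(p : 'I_l * 'I_l | asc p) F p.1 p.2 = \sum_(u < l) \sum_(a < l - u.+1) F a (a + u.+1).
Proof.
transitivity (\sum_(a < l) \sum_(b < l | a < b) F a b); first by rewrite pair_big_dep.
under eq_bigr do rewrite (@sum_ord_gt l _ (F _)).
rewrite (exchange_big_dep xpredT) //=; apply: eq_bigr => u _.
rewrite (big_ord_widen l (fun a => F a (a + u.+1))) ?leq_subr //.
by apply: eq_bigl => a; lia.
Qed.

Lemma sum_asc3 (F : nat -> nat -> nat -> nat) :
  \sum_(t : 'I_l * 'I_l * 'I_l | asc3 t) F t.1.1 t.1.2 t.2 =
  \sum_(u < l) \sum_(v < l) \sum_(a < l - (u.+1 + v.+1)) F a (a + u.+1) (a + u.+1 + v.+1).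
Proof.
transitivity (\sum_(a < l) \sum_(b < l | a < b) \sum_(c < l | b < c) F a b c).
  under [RHS]eq_bigr do rewrite pair_big_dep /=.
  rewrite pair_big_dep /= (reindex (fun x : 'I_l * ('I_l * 'I_l) => (x.1, x.2.1, x.2.2))) //=.
  by exists (fun x => (x.1.1, (x.1.2, x.2))) => [[a [b c]] _|[[a b] c] _].
transitivity (\sum_(a < l) \sum_(u < l) \sum_(v < l | a + u.+1 + v.+1 < l) F a (a + u.+1) (a + u.+1 + v.+1)).
  apply: eq_bigr => a _.
  rewrite (@sum_ord_gt l a (fun b => \sum_(c < l | b < c) F a b c)) big_mkcond /=.
  apply: eq_bigr => u _; rewrite sum_ord_gt.
  by case: ifP => // h; rewrite big1 // => v; lia.
rewrite exchange_big /=; apply: eq_bigr => u _.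
rewrite (exchange_big_dep xpredT) //=; apply: eq_bigr => v _.
rewrite (big_ord_widen l (fun a => F a (a + u.+1) (a + u.+1 + v.+1))) ?leq_subr //.
by apply: eq_bigl => a; lia.
Qed.

Lemma card_ord_between m n : #|[pred a : 'I_l | m <= a < n]| = minn n l - m.
Proof.
rewrite -sum1_card.
transitivity (\sum_(i < l | (i < n) && (m <= i)) 1); first by apply: eq_bigl => i; rewrite andbC.
elim: l => [|k IH]; first by rewrite big_ord0 minn0.
by rewrite big_mkcond big_ord_recr -big_mkcond IH /=; case: ifP; lia.
Qed.

(** The smaller element a of the pair is subject to s - a < l and 2a < s, that is, to
    [s.+1 - l <= a < uphalf s]. *)
Lemma pair_sum_countE s : pair_sum_count l s = uphalf s - (s.+1 - l).
Proof.
have ltu a : (a < uphalf s) = (a.*2 < s).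
  by rewrite uphalf_half; have := odd_double_half s; lia.
rewrite /pair_sum_count -sum1_card.
transitivity (\sum_(p : 'I_l * 'I_l | asc p) (p.1 + p.2 == s)).
  by rewrite big_mkcondr /=; apply: eq_bigr => p _; rewrite /psum; case: (_ == s).
transitivity (\sum_(a < l) ((s.+1 - l <= a) && (a < uphalf s)) * \sum_(b < l) (b == s - a :> nat)).
  transitivity (\sum_(a < l) \sum_(b < l | a < b) (a + b == s)); first by rewrite pair_big_dep.
  apply: eq_bigr => a _; rewrite big_distrr big_mkcond; apply: eq_bigr => b _ /=.
  rewrite ltu; have := ltn_ord b.
  by case: leqP => ?; case: ltnP => ?; rewrite ?mul0n ?mul1n; do ?[case: eqP => ?]; lia.
transitivity (\sum_(a < l) ((s.+1 - l <= a) && (a < uphalf s))).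
  apply: eq_bigr => a _; rewrite sum_ord_eq ltu; have := ltn_ord a.
  by case: (leqP (s.+1 - l) a) => //= ?; case: ltnP => ?; lia.
transitivity (#|[pred a : 'I_l | s.+1 - l <= a < uphalf s]|).
  by rewrite -sum1_card [RHS]big_mkcond; apply: eq_bigr => a _; rewrite unfold_in /=; case: (_ && _).
by rewrite card_ord_between uphalf_half; have := odd_double_half s; lia.
Qed.

End Reindex.

(** * Factorial moments of the number of pairs with a given sum *)

Definition mult (l s : nat) := uphalf s - (s.+1 - l).
Definition Psum (c : pred nat) k l := \sum_(s < l.*2 | c s) mult l s ^_ k.

Lemma ffactn_rec n k : n.+1 ^_ k.+1 = n ^_ k.+1 + k.+1 * n ^_ k.
Proof.
rewrite ffactSS ffactnSr [_ * (n - k)]mulnC -mulnDl.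
have [kn|nk] := leqP k n; first by congr (_ * _); lia.
by rewrite ffact_small // !muln0.
Qed.

(** The pairs of sum s + 2 in length l + 2 are the shifted pairs of sum s in length l and exactly
    one pair containing an end of the interval. So [mult] grows by 1 and [ffactn_rec] applies. *)
Lemma Psum_rec (c : pred nat) k l : (forall s, c s.+2 = c s) ->
  Psum c k.+1 l.+2 = c 1 * (k == 0) + Psum c k.+1 l + k.+1 * Psum c k l.
Proof.
move=> cS; rewrite /Psum -[l.+2.*2]/(l.*2.+4) big_mkcond /=.
(* Of the four boundary values of s, only s = 1 has a pair, namely {0, 1}; it contributes only when
   k = 0. *)
rewrite big_ord_recl big_ord_recl big_ord_recr big_ord_recr /=.
have e1 : mult l.+2 (bump 0 (bump 0 l.*2)) = 0.
  by rewrite /mult /bump /= uphalf_double; lia.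
have e2 : mult l.+2 (bump 0 (bump 0 l.*2.+1)) = 0.
  by rewrite /mult /bump /= doubleK; lia.
rewrite e1 e2 ffact0n !if_same !addn0 {e1 e2}.
rewrite add0n -addnA; congr (_ + _).
  by rewrite /bump /= /mult /= subn0; case: (c 1) k => [] [|k].
rewrite big_distrr [X in _ = X + _]big_mkcond [X in _ = _ + X]big_mkcond -big_split.
apply: eq_bigr => s _; rewrite /bump !add1n cS; case: ifP => // _.
rewrite /= -ffactn_rec; congr (_ ^_ _).
rewrite /mult /= uphalf_half; have := odd_double_half s; have := ltn_ord s; lia.
Qed.

Lemma Psum0 c l : Psum c 0 l = \sum_(s < l.*2) c s.
Proof. by rewrite /Psum big_mkcond; apply: eq_bigr => s _; case: (c s). Qed.

Notation Pall := (Psum xpredT).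
Notation Peven := (Psum (fun s => ~~ odd s)).

Lemma Pall0 l : Pall 0 l = l.*2.
Proof. by rewrite Psum0 sum_nat_const card_ord muln1. Qed.

Lemma Peven0 l : Peven 0 l = l.
Proof.
rewrite Psum0; elim: l => [|l IH]; first by rewrite big_ord0.
by rewrite doubleS !big_ord_recr /= IH odd_double; lia.
Qed.

(** The recurrence advances l by 2, so these moments are polynomial on each parity class; both
    classes go through one induction. *)
Lemma Pall1 n : Pall 1 n.*2 + n = 2 * n ^ 2 /\ Pall 1 n.*2.+1 = n + 2 * n ^ 2.
Proof.
elim: n => [|n [h0 h1]]; first by split; rewrite /Psum big_mkcond /= ?big_ord_recl big_ord0.
by rewrite doubleS !Psum_rec // !Pall0; split; lia.
Qed.

Lemma Pall2 n : 3 * Pall 2 n.*2 + 9 * n ^ 2 = 5 * n + 4 * n ^ 3 /\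
  3 * Pall 2 n.*2.+1 + n + 3 * n ^ 2 = 4 * n ^ 3.
Proof.
elim: n => [|n [h0 h1]]; first by split; rewrite /Psum big_mkcond /= ?big_ord_recl big_ord0.
by have [] := Pall1 n; rewrite doubleS !Psum_rec //; split; lia.
Qed.

Lemma Pall3 n : Pall 3 n.*2 + 4 * n + 5 * n ^ 3 = 8 * n ^ 2 + n ^ 4 /\
  Pall 3 n.*2.+1 + 3 * n ^ 3 = 2 * n ^ 2 + n ^ 4.
Proof.
elim: n => [|n [h0 h1]]; first by split; rewrite /Psum big_mkcond /= ?big_ord_recl big_ord0.
by have [] := Pall2 n; rewrite doubleS !Psum_rec //; split; lia.
Qed.

Lemma Peven1 n : Peven 1 n.*2 + n = n ^ 2 /\ Peven 1 n.*2.+1 = n ^ 2.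
Proof.
elim: n => [|n [h0 h1]].
  by split; rewrite /Psum big_mkcond /= ?big_ord_recl big_ord0.
by rewrite doubleS !Psum_rec => [|s|s]; rewrite ?negbK // !Peven0; split; lia.
Qed.

Lemma Peven2 n : 3 * Peven 2 n.*2 + 6 * n ^ 2 = 4 * n + 2 * n ^ 3 /\
  3 * Peven 2 n.*2.+1 + 3 * n ^ 2 = n + 2 * n ^ 3.
Proof.
elim: n => [|n [h0 h1]].
  by split; rewrite /Psum big_mkcond /= ?big_ord_recl big_ord0.
by have [] := Peven1 n; rewrite doubleS !Psum_rec => [|s|s]; rewrite ?negbK //; split; lia.
Qed.

Lemma sum_lin_0 k : sum_lin k 0 = 0. Proof. by rewrite /sum_lin big_ord0. Qed.

Lemma sum_lin_small k l : l <= k -> sum_lin k l = 0.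
Proof. by move=> lk; rewrite /sum_lin big1 // => v _; nia. Qed.

Lemma sum_lin1 l : 2 * sum_lin 1 l + l = l ^ 2.
Proof. by elim: l => [|l IH]; rewrite ?sum_lin_0 // -(addn1 l) sum_lin_rec //; lia. Qed.

Lemma sum_lin_2 n : sum_lin 2 n.*2 + n = n ^ 2 /\ sum_lin 2 n.*2.+1 = n ^ 2.
Proof.
elim: n => [|n [h0 h1]]; first by rewrite !sum_lin_small.
by rewrite doubleS -(addn2 n.*2.+1) -(addn2 n.*2) !sum_lin_rec //; split; lia.
Qed.

Lemma sum_lin_4 n : [/\ sum_lin 4 (4 * n) + 2 * n = 2 * n ^ 2, sum_lin 4 (4 * n).+1 + n = 2 * n ^ 2,
  sum_lin 4 (4 * n).+2 = 2 * n ^ 2 & sum_lin 4 (4 * n).+3 = n + 2 * n ^ 2].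
Proof.
elim: n => [|n [h0 h1 h2 h3]]; first by rewrite !sum_lin_small.
have r i : sum_lin 4 (4 * n.+1 + i) = 4 * n + i + sum_lin 4 (4 * n + i).
  by rewrite -sum_lin_rec //; congr sum_lin; lia.
move: (r 0) (r 1) (r 2) (r 3); rewrite !addn0 !addn1 !addn2 !addn3 => r0 r1 r2 r3.
by split; lia.
Qed.

Lemma sum_lin2_1_2 n : 6 * sum_lin2 1 2 n.*2 + 9 * n ^ 2 = 5 * n + 4 * n ^ 3 /\
  6 * sum_lin2 1 2 n.*2.+1 + n + 3 * n ^ 2 = 4 * n ^ 3.
Proof.
(* With the coefficient 2 in front, the recurrence advances l by 2 and fits the induction on n. *)
rewrite !(sum_lin2C 1); elim: n => [|n [h0 h1]].
  by rewrite /sum_lin2 !big_ord_recl !big_ord0.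
rewrite doubleS -(addn2 n.*2.+1) -(addn2 n.*2) !sum_lin2_rec //.
by have := sum_lin1 n.*2; have := sum_lin1 n.*2.+1; split; lia.
Qed.

Lemma sum_lin2_2_2 n : 3 * sum_lin2 2 2 n.*2 + 3 * n ^ 2 = 2 * n + n ^ 3 /\
  6 * sum_lin2 2 2 n.*2.+1 + 3 * n ^ 2 = n + 2 * n ^ 3.
Proof.
elim: n => [|n [h0 h1]]; first by rewrite /sum_lin2 !big_ord_recl !big_ord0.
rewrite doubleS -(addn2 n.*2.+1) -(addn2 n.*2) !sum_lin2_rec //.
by have [] := sum_lin_2 n; split; lia.
Qed.

(** Ordered pairs of distinct index pairs with common gap [2 * t.+1], overlapping ones included;
    [sum_apart2] removes the overlaps. *)
Definition even_gap_pairs l := \sum_(t < l) (l - 2 * t.+1) ^_ 2.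

Lemma even_gap_pairs_rec l : even_gap_pairs l.+2 = l ^_ 2 + even_gap_pairs l.
Proof.
rewrite /even_gap_pairs big_ord_recl muln1; congr (_ + _); first by congr (_ ^_ _); lia.
rewrite big_ord_recr /= /bump /= addnC [X in X + _](_ : _ = 0) ?add0n.
  by apply: eq_bigr => t _; congr (_ ^_ _); lia.
by rewrite (_ : _ - _ = 0) //; lia.
Qed.

Lemma ffact2 n : n ^_ 2 + n = n ^ 2.
Proof. by case: n => // n; rewrite !ffactnS ffactn0 /=; lia. Qed.

Lemma ffact3 n : n ^_ 3 + 3 * n ^ 2 = n ^ 3 + 2 * n.
Proof. by case: n => [|[|n]] //; rewrite !ffactnS ffactn0 /=; lia. Qed.

Lemma even_gap_pairsE n : 3 * even_gap_pairs n.*2 + 9 * n ^ 2 = 5 * n + 4 * n ^ 3 /\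
  3 * even_gap_pairs n.*2.+1 + n + 3 * n ^ 2 = 4 * n ^ 3.
Proof.
elim: n => [|n [h0 h1]]; first by rewrite /even_gap_pairs !big_ord_recl !big_ord0.
rewrite doubleS !even_gap_pairs_rec //.
by have := ffact2 n.*2; have := ffact2 n.*2.+1; split; lia.
Qed.

(** The sum over gaps d of m * (m - d) with m = l - d, the quadratic correction in
    [far_triplesE]. *)
Definition gap_products l := \sum_(t < l) (l - t.+1) * (l - 2 * t.+1).

Lemma gap_products_rec l : gap_products l.+2 = l.+1 * l + gap_products l + sum_lin 2 l.
Proof.
rewrite /gap_products /sum_lin big_ord_recl muln1 -addnA; congr (_ + _); first by congr (_ * _); lia.
rewrite big_ord_recr /= /bump /= addnC [X in X + _](_ : _ = 0) ?add0n.
  rewrite -big_split; apply: eq_bigr => t _ /=.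
  rewrite (_ : l.+2 - _ = (l - t.+1).+1); last by have := ltn_ord t; lia.
  by rewrite mulSn addnC; congr (_ * _ + _); lia.
by apply/eqP; rewrite muln_eq0; lia.
Qed.

Lemma gap_productsE n : 3 * gap_products n.*2 + 6 * n ^ 2 = n + 5 * n ^ 3 /\
  6 * gap_products n.*2.+1 + n = 3 * n ^ 2 + 10 * n ^ 3.
Proof.
elim: n => [|n [h0 h1]]; first by rewrite /gap_products !big_ord_recl !big_ord0.
rewrite doubleS !gap_products_rec //.
by have [] := sum_lin_2 n; split; lia.
Qed.

Definition sum_ffact3 l := \sum_(m < l) m ^_ 3.

Lemma sum_ffact3E l : 4 * sum_ffact3 l + 6 * l ^ 3 + 6 * l = l ^ 4 + 11 * l ^ 2.
Proof.
elim: l => [|l IH]; first by rewrite /sum_ffact3 big_ord0.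
by rewrite /sum_ffact3 big_ord_recr -/(sum_ffact3 l) /=; have := ffact3 l; lia.
Qed.

Lemma sum_ge m k : \sum_(a < m) (k <= a) = m - k.
Proof.
rewrite -[RHS](_ : minn m m - k = _); last by rewrite minnn.
rewrite -card_ord_between -sum1_card [RHS]big_mkcond.
by apply: eq_bigr => a _; rewrite unfold_in /= ltn_ord andbT; case: (k <= a).
Qed.

Lemma sum_lt m k : \sum_(a < m) (a + k < m) = m - k.
Proof.
rewrite -(sum_ge m k) (reindex_inj rev_ord_inj) /=; apply: eq_bigr => a _.
by have := ltn_ord a; lia.
Qed.

Lemma sum_ge_lt m j k : \sum_(a < m) (j <= a) * (a + k < m) = m - k - j.
Proof.
rewrite -[RHS](_ : minn (m - k) m - j = _); last by lia.
rewrite -card_ord_between -sum1_card [RHS]big_mkcond.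
apply: eq_bigr => a _; rewrite unfold_in /= mulnb.
by rewrite (_ : (a + k < m) = (a < m - k)); [case: (_ && _) | lia].
Qed.

(** * Disjoint translates of a two-point set, by inclusion and exclusion *)

Section Far.
Variables d m : nat.
Hypothesis d0 : 0 < d.

(* The pairs [{a, a + d}] and [{b, b + d}] are disjoint. *)
Definition far (a b : nat) := [&& a != b, a != b + d & b != a + d].
(** The number of translates meeting the one at a: those at a itself, a - d and a + d, as far as
    they are in range. *)
Definition kappa a := 1 + (d <= a) + (a + d < m).

Lemma sum_near a : a < m -> \sum_(c < m) ~~ far a c = kappa a.
Proof.
move=> am; transitivity (\sum_(c < m) ((c == a :> nat) + (d <= a) * (c == a - d :> nat) + (c == a + d :> nat))).
  apply: eq_bigr => c _; rewrite /far.
  by case: (leqP d a) => ?; rewrite ?mul0n ?mul1n; lia.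
by rewrite !big_split -big_distrr /= !sum_ord_eq am /kappa; case: (leqP d a) => ?; lia.
Qed.

(** Two positions that are far from each other have a common near position only if they differ by
    2d, and then it is their midpoint. *)
Lemma sum_near_near a b : a < m -> b < m -> far a b ->
  \sum_(c < m) ~~ far a c * ~~ far b c = (a == b + 2 * d) + (b == a + 2 * d).
Proof.
move=> am bm fab.
transitivity (\sum_(c < m) ((a == b + 2 * d) * (c == b + d :> nat) + (b == a + 2 * d) * (c == a + d :> nat))).
  apply: eq_bigr => c _; rewrite mulnb -negb_or; move: fab; rewrite /far => /and3P[/eqP n1 /eqP n2 /eqP n3].
  case: (a =P b + 2 * d) => e1; case: (b =P a + 2 * d) => e2; rewrite ?mul0n ?mul1n; lia.
rewrite !big_split -!big_distrr /= !sum_ord_eq.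
by case: (a =P b + 2 * d) => e1; case: (b =P a + 2 * d) => e2; rewrite ?mul0n ?mul1n; lia.
Qed.

Lemma sum_far a : a < m -> \sum_(c < m) far a c + kappa a = m.
Proof.
move=> am; rewrite -sum_near // -big_split /= -[RHS]card_ord -sum1_card.
by apply: eq_bigr => c _; case: far.
Qed.

Lemma sum_far_far a b : a < m -> b < m -> far a b ->
  \sum_(c < m) far a c * far b c + kappa a + kappa b = m + (a == b + 2 * d) + (b == a + 2 * d).
Proof.
move=> am bm fab; rewrite -[RHS]addnA -sum_near_near // -sum_near // -sum_near //.
transitivity (\sum_(c < m) (1 + ~~ far a c * ~~ far b c)); last by rewrite big_split sum1_card card_ord.
rewrite -!big_split /=.
by apply: eq_bigr => c _; do 2!case: far.
Qed.

Lemma sum_kappa : \sum_(a < m) kappa a = m + 2 * (m - d).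
Proof. by rewrite !big_split /= sum_ge sum_lt sum1_card card_ord; lia. Qed.

Lemma sum_kappa_sq : \sum_(a < m) kappa a ^ 2 = m + 6 * (m - d) + 2 * (m - 2 * d).
Proof.
(* For indicators x and y, (1 + x + y)^2 = 1 + 3x + 3y + 2xy. *)
transitivity (\sum_(a < m) (1 + ((d <= a) + (d <= a) + (d <= a)) +
    ((a + d < m) + (a + d < m) + (a + d < m)) + ((d <= a) * (a + d < m) + (d <= a) * (a + d < m)))).
  by apply: eq_bigr => a _; rewrite /kappa; do 2!case: (_ <= _).
by rewrite !big_split /= sum_ge sum_lt sum_ge_lt sum1_card card_ord; lia.
Qed.

Definition far_pairs := \sum_(a < m) \sum_(b < m) far a b.
Definition far_triples := \sum_(a < m) \sum_(b < m) \sum_(c < m) far a b * (far a c * far b c).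

Lemma far_pairsE : far_pairs + m + 2 * (m - d) = m ^ 2.
Proof.
rewrite -addnA -sum_kappa -big_split /=.
under eq_bigr => a _ do rewrite sum_far ?ltn_ord //.
by rewrite sum_nat_const card_ord.
Qed.

Lemma sum_far_kappa :
  \sum_(a < m) \sum_(b < m) far a b * kappa a + \sum_(a < m) kappa a ^ 2 = m * \sum_(a < m) kappa a.
Proof.
rewrite -big_split big_distrr; apply: eq_bigr => a _ /=.
by rewrite -big_distrl -mulnn -mulnDl sum_far.
Qed.

Lemma far_sym a b : far a b = far b a.
Proof. by rewrite /far eq_sym; congr (_ && _); rewrite andbC. Qed.

Lemma sum_far_double_gap : \sum_(a < m) \sum_(b < m) far a b * (a == b + 2 * d :> nat) = m - 2 * d.
Proof.
rewrite exchange_big /= -sum_lt; apply: eq_bigr => b _.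
rewrite -sum_ord_eq; apply: eq_bigr => a _; rewrite /far.
by case: (_ =P b + _) => ?; rewrite ?muln0 ?muln1 //; lia.
Qed.

Lemma far_triplesE :
  far_triples + 3 * m ^ 2 + 6 * m * (m - d) = m ^ 3 + 2 * m + 12 * (m - d) + 6 * (m - 2 * d).
Proof.
pose K := \sum_(a < m) \sum_(b < m) far a b * kappa a.
pose G := \sum_(a < m) \sum_(b < m) far a b * (a == b + 2 * d :> nat).
(* This sums [sum_far_far] over all far pairs (a, b); exchanging a and b turns the two kappa terms
   into K twice and the two midpoint terms into G twice. *)
have e : far_triples + (K + K) = m * far_pairs + (G + G).
  rewrite [X in _ + (_ + X)]exchange_big [X in _ = _ + (_ + X)]exchange_big.
  rewrite /far_pairs big_distrr -!big_split; apply: eq_bigr => a _ /=.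
  rewrite big_distrr -!big_split; apply: eq_bigr => b _ /=.
  rewrite -big_distrr /= (far_sym b); case: (boolP (far a b)) => fab; rewrite ?mul0n ?muln0 //.
  have h := sum_far_far (ltn_ord a) (ltn_ord b) fab.
  by rewrite !mul1n muln1 [LHS]addnA h -addnA.
have := sum_far_kappa; rewrite -/K sum_kappa_sq sum_kappa.
have := far_pairsE; have : G = m - 2 * d by exact: sum_far_double_gap.
by move: e; lia.
Qed.

End Far.

(** * The counts expressed through one-variable sums *)

Section Evaluate.
Variable l : nat.

Lemma sum_same_gap (d : nat) (F : nat -> nat) : 0 < d ->
  \sum_(q : 'I_l * 'I_l | asc q) (d == gap q) * F q.1 = \sum_(b < l - d) F b.
Proof.
case: d => // u _; rewrite (@sum_asc l (fun b b' => (u.+1 == b' - b) * F b)).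
under eq_bigr => v _.
  under eq_bigr do rewrite addKn.
  rewrite -big_distrr /=; over.
have [ul|lu] := ltnP u l.
  rewrite (bigD1 (Ordinal ul)) //= eqxx mul1n [X in _ + X]big1 ?addn0 // => v.
  by rewrite -val_eqE /= => vu; rewrite eqSS eq_sym (negbTE vu).
rewrite (_ : l - u.+1 = 0) ?big_ord0 ?big1 // => [v _|]; last by lia.
by rewrite (_ : _ == _ = false) //; have := ltn_ord v; lia.
Qed.

Lemma gap_gt0 (p : 'I_l * 'I_l) : asc p -> 0 < gap p.
Proof. by rewrite /asc /gap subn_gt0. Qed.

Lemma asc_snd (p : 'I_l * 'I_l) : asc p -> p.2 = p.1 + gap p :> nat.
Proof. by rewrite /asc /gap; lia. Qed.

Lemma apart_far (p q : 'I_l * 'I_l) : asc p -> asc q -> gap p = gap q ->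
  apart p q = far (gap p) p.1 q.1.
Proof.
move=> pp pq e; rewrite /apart -!val_eqE /= (asc_snd pp) (asc_snd pq) -e /far.
by rewrite eqn_add2r (eq_sym (_ + _) (q.1 : nat)); do 3!case: eqP.
Qed.

Lemma sum_even_gaps (f : nat -> nat) : (forall d, l <= d -> f d = 0) ->
  \sum_(u < l) ~~ odd u.+1 * f u.+1 = \sum_(t < l) f (2 * t.+1).
Proof.
move=> f0; pose g u := ~~ odd u.+1 * f u.+1.
have g2 n : \sum_(u < n.*2) g u = \sum_(t < n) f (2 * t.+1).
  elim: n => [|n IH]; first by rewrite !big_ord0.
  rewrite doubleS !big_ord_recr /= IH /g /= odd_double mul0n addn0 mul1n.
  by congr (_ + f _); lia.
rewrite -g2 -(sum_ord_trunc (f := g) (n := l.*2)) //; first by lia.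
by move=> u lu; rewrite /g f0 ?muln0 //; lia.
Qed.

(** Distinct pairs of gap d overlap exactly when they form a progression of step d with three terms.
    There are l - 2d of these, each met in two orders, and d = 2(t + 1) gives [sum_lin 4]. *)
Lemma sum_apart2 :
  \sum_(p : 'I_l * 'I_l | asc p) \sum_(q | asc q && apart p q) (~~ odd (gap p) && (gap p == gap q))
  + 2 * sum_lin 4 l = even_gap_pairs l.
Proof.
transitivity (\sum_(u < l) ~~ odd u.+1 * far_pairs u.+1 (l - u.+1) + 2 * sum_lin 4 l).
  congr (_ + _).
  transitivity (\sum_(p : 'I_l * 'I_l | asc p) ~~ odd (p.2 - p.1) *
    \sum_(b < l - (p.2 - p.1)) far (p.2 - p.1) p.1 b).
    apply: eq_bigr => p pp.
    rewrite -(sum_same_gap (fun b => far (gap p) p.1 b : nat) (gap_gt0 pp)) big_distrr big_mkcondr.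
    apply: eq_bigr => q pq /=; case: (gap p =P gap q) => e; last by rewrite andbF mul0n muln0 if_same.
    by rewrite andbT mul1n -apart_far //; case: apart; rewrite ?muln1 ?muln0.
  rewrite (@sum_asc l (fun a a' => ~~ odd (a' - a) * \sum_(b < l - (a' - a)) far (a' - a) a b)).
  apply: eq_bigr => u _; rewrite /far_pairs big_distrr; apply: eq_bigr => a _.
  by rewrite addKn.
have -> : sum_lin 4 l = \sum_(t < l) (l - 4 * t.+1) by [].
rewrite big_distrr /even_gap_pairs.
transitivity (\sum_(t < l) (far_pairs (2 * t.+1) (l - 2 * t.+1) + 2 * (l - 4 * t.+1))); last first.
  apply: eq_bigr => t _; have := far_pairsE (d := 2 * t.+1) (l - 2 * t.+1) isT.
  by have := ffact2 (l - 2 * t.+1); rewrite -subnDA -mulnDl; lia.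
rewrite [RHS]big_split; congr (_ + _); apply: (sum_even_gaps (f := fun d => far_pairs d (l - d))).
by move=> d ld; rewrite /far_pairs (_ : l - d = 0) ?big_ord0 //; lia.
Qed.

(** This is [far_triplesE] with m = l - d summed over d, where m - d = l - 2d and m - 2d = l -
    3d. *)
Lemma sum_apart3 :
  \sum_(p : 'I_l * 'I_l | asc p) \sum_(q | asc q && apart p q)
    \sum_(r | [&& asc r, apart p r & apart q r]) ((gap p == gap q) && (gap p == gap r))
  + 6 * gap_products l = sum_ffact3 l + 12 * sum_lin 2 l + 6 * sum_lin 3 l.
Proof.
transitivity (\sum_(u < l) far_triples u.+1 (l - u.+1) + 6 * gap_products l).
  congr (_ + _).
  transitivity (\sum_(p : 'I_l * 'I_l | asc p) \sum_(b < l - (p.2 - p.1)) \sum_(c < l - (p.2 - p.1))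
      far (p.2 - p.1) p.1 b * (far (p.2 - p.1) p.1 c * far (p.2 - p.1) b c)).
    apply: eq_bigr => p pp; rewrite -!/(gap p); set d := gap p.
    rewrite -(sum_same_gap (fun b => \sum_(c < l - d) far d p.1 b * (far d p.1 c * far d b c))
      (gap_gt0 pp)) big_mkcondr.
    apply: eq_bigr => q pq /=; rewrite -/d.
    rewrite -(sum_same_gap (fun c => far d p.1 q.1 * (far d p.1 c * far d q.1 c)) (gap_gt0 pp)) -/d.
    case: (d =P gap q) => e; last by rewrite mul0n; case: ifP => // _; rewrite big1.
    rewrite mul1n (apart_far pp pq e) -/d; case: (far d p.1 q.1); last first.
      by rewrite big1 // => r _; rewrite mul0n muln0.
    rewrite big_mkcondr; apply: eq_bigr => r pr /=; rewrite mul1n -/d.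
    case: (d =P gap r) => e'; last by rewrite mul0n if_same.
    rewrite mul1n (apart_far pp pr e') (apart_far pq pr) -?e // -/d.
    by do 2!case: far.
  rewrite (@sum_asc l (fun a a' => \sum_(b < l - (a' - a)) \sum_(c < l - (a' - a))
    far (a' - a) a b * (far (a' - a) a c * far (a' - a) b c))).
  by apply: eq_bigr => u _; rewrite /far_triples; apply: eq_bigr => a _; rewrite addKn.
have -> : sum_ffact3 l = \sum_(u < l) (l - u.+1) ^_ 3.
  by rewrite /sum_ffact3 (reindex_inj rev_ord_inj).
rewrite /gap_products /sum_lin !big_distrr -!big_split; apply: eq_bigr => u _ /=.
have := far_triplesE (d := u.+1) (l - u.+1) isT; have := ffact3 (l - u.+1).
rewrite -!subnDA (_ : u.+1 + u.+1 = 2 * u.+1) 1?(_ : u.+1 + 2 * u.+1 = 3 * u.+1); lia.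
Qed.

Lemma sum_completions :
  \sum_(t : 'I_l * 'I_l * 'I_l | asc3 t) completions t ^_ 2 + 4 * sum_lin 3 l =
  2 * (2 * sum_lin2 1 2 l + sum_lin2 2 2 l).
Proof.
pose B (a b c : nat) : nat := (c <= a + b) + (a + c != b.*2) + (b + c < l + a).
rewrite (@sum_asc3 l (fun a b c => B a b c ^_ 2)).
(* For three indicators the falling factorial of their sum is 2(e1 e2 + e1 e3 + e2 e3). Here e2 is 1
   - [u = v]; the terms with u = v are moved to the left and add up to [4 * sum_lin 3 l]. *)
have E u v : \sum_(a < l - (u.+1 + v.+1)) B a (a + u.+1) (a + u.+1 + v.+1) ^_ 2 +
    2 * (u == v) * ((l - 1 * u.+1 - 2 * v.+1) + (l - 2 * u.+1 - 1 * v.+1)) =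
    2 * ((l - 1 * u.+1 - 2 * v.+1) + (l - 2 * u.+1 - 1 * v.+1) + (l - 2 * u.+1 - 2 * v.+1)).
  set n := l - (u.+1 + v.+1).
  have -> : l - 1 * u.+1 - 2 * v.+1 = \sum_(a < n) (v.+1 <= a) by rewrite sum_ge; lia.
  have -> : l - 2 * u.+1 - 1 * v.+1 = \sum_(a < n) (a + u.+1 < n) by rewrite sum_lt; lia.
  have -> : l - 2 * u.+1 - 2 * v.+1 = \sum_(a < n) (v.+1 <= a) * (a + u.+1 < n).
    by rewrite sum_ge_lt; lia.
  rewrite -!big_split !big_distrr -big_split; apply: eq_bigr => a _ /=.
  rewrite /B (_ : (_ <= _ + _) = (v.+1 <= a)); last by lia.
  rewrite (_ : (_ != _) = (u != v)); last by lia.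
  rewrite (_ : (_ < l + _) = (a + u.+1 < n)); last by rewrite /n; lia.
  by case: (u == v); case: (v < a); case: (_ < n).
transitivity (2 * (sum_lin2 1 2 l + sum_lin2 2 1 l + sum_lin2 2 2 l)); last by rewrite (sum_lin2C 2 1); lia.
rewrite -!big_split [RHS]big_distrr.
have -> : 4 * sum_lin 3 l = \sum_(u < l) \sum_(v < l)
    2 * (u == v :> nat) * ((l - 1 * u.+1 - 2 * v.+1) + (l - 2 * u.+1 - 1 * v.+1)).
  rewrite big_distrr; apply: eq_bigr => u _.
  rewrite (bigD1 u) //= big1 ?addn0 => [|v]; first by rewrite eqxx; lia.
  by rewrite -val_eqE eq_sym /= => /negbTE->; rewrite muln0.
rewrite -big_split; apply: eq_bigr => u _ /=.
by rewrite -!big_split big_distrr /=; apply: eq_bigr => v _; rewrite -E.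
Qed.

Lemma card_parity (s : nat) : s < 2 ->
  #|[pred x : 'I_l | odd x == s :> nat]| = if s == 0 then uphalf l else l./2.
Proof.
move=> s2; rewrite -sum1_card.
transitivity (\sum_(x < l) (odd x == s :> nat)).
  by rewrite [LHS]big_mkcond; apply: eq_bigr => x _; rewrite unfold_in /=; case: (_ == s).
elim: l => [|n IH]; first by rewrite big_ord0; case: eqP.
rewrite big_ord_recr IH /= uphalf_half.
by case: s s2 {IH} => [|[|]] //= _; case: (odd n); rewrite /=; lia.
Qed.

Lemma triple_sum_222E :
  triple_sum (@weight2 l) (@weight2 l) (@weight2 l) = uphalf l ^_ 3 + l./2 ^_ 3.
Proof. by rewrite triple_sum_222 !big_ord_recl big_ord0 !card_parity // addn0. Qed.

Lemma sum_mult c k : \sum_(s < l.*2 | c (nat_of_ord s)) pair_sum_count l s ^_ k = Psum c k l.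
Proof. by apply: eq_bigr => s _; rewrite pair_sum_countE. Qed.

Definition weight (A : {set 'I_l}) := weight2 A + weight4 A.

Lemma sum_weight_sqE : \sum_(A : {set 'I_l}) weight A ^ 2 = Peven 1 l + 2 * Pall 2 l.
Proof.
rewrite sum_weight_sq -!sum_mult; congr (_ + _); apply: eq_bigr => s _.
by rewrite ffactn1.
Qed.

Lemma triple_sum_weightE : triple_sum weight weight weight =
  uphalf l ^_ 3 + l./2 ^_ 3 + 3 * (2 * (Peven 2 l + (even_gap_pairs l - 2 * sum_lin 4 l)))
  + 3 * (4 * (2 * (2 * sum_lin2 1 2 l + sum_lin2 2 2 l) - 4 * sum_lin 3 l))
  + 8 * (Pall 3 l + (sum_ffact3 l + 12 * sum_lin 2 l + 6 * sum_lin 3 l - 6 * gap_products l)).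
Proof.
rewrite triple_sumD triple_sum_222E triple_sum_224 triple_sum_442 triple_sum_444.
rewrite -sum_apart2 addnK -sum_completions addnK -sum_apart3 addnK.
rewrite -!sum_mult -(sum_fibre3 (D := @asc l) (h := @psum l) (n := l.*2)) //.
by move=> [a b] _; rewrite /psum /=; have := ltn_ord a; have := ltn_ord b; lia.
Qed.

End Evaluate.

Lemma variance_count n :
  12 * (\sum_(A : {set 'I_n.*2}) weight A ^ 2) + 15 * n.*2 ^ 2 = 4 * n.*2 ^ 3 + 14 * n.*2 /\
  12 * (\sum_(A : {set 'I_n.*2.+1}) weight A ^ 2) + 15 * n.*2.+1 ^ 2 + 3 =
    4 * n.*2.+1 ^ 3 + 14 * n.*2.+1.
Proof.
by rewrite !sum_weight_sqE; have [] := Peven1 n; have [] := Pall2 n; split; lia.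
Qed.

Definition third_count l := triple_sum (@weight l) (@weight l) (@weight l).

(* The correction terms are kept as unknowns to avoid truncated subtraction. *)
Lemma third_countE l : exists x : nat * nat * nat,
  [/\ third_count l = uphalf l ^_ 3 + l./2 ^_ 3 + 6 * Peven 2 l + 8 * Pall 3 l
        + 6 * x.1.1 + 12 * x.1.2 + 8 * x.2,
      x.1.1 + 2 * sum_lin 4 l = even_gap_pairs l,
      x.1.2 + 4 * sum_lin 3 l = 2 * (2 * sum_lin2 1 2 l + sum_lin2 2 2 l) &
      x.2 + 6 * gap_products l = sum_ffact3 l + 12 * sum_lin 2 l + 6 * sum_lin 3 l].
Proof.
exists (even_gap_pairs l - 2 * sum_lin 4 l,
  2 * (2 * sum_lin2 1 2 l + sum_lin2 2 2 l) - 4 * sum_lin 3 l,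
  sum_ffact3 l + 12 * sum_lin 2 l + 6 * sum_lin 3 l - 6 * gap_products l) => /=.
rewrite /third_count triple_sum_weightE -sum_apart2 addnK -sum_completions addnK -sum_apart3 addnK.
by split => //; lia.
Qed.

(** The four residue classes modulo 4 collapse to two formulas: only l = 2n with n odd needs a
    correction, so 1 and 3 modulo 4 will agree. *)
Lemma sum_lin_4_parity n :
  2 * sum_lin 4 n.*2 + 2 * n = n ^ 2 + odd n /\ 2 * sum_lin 4 n.*2.+1 + n = n ^ 2.
Proof.
have := odd_double_half n; move: (n./2) => k; have [h0 h1 h2 h3] := sum_lin_4 k.
case: (odd n) => /= <-.
  rewrite (_ : (1 + k.*2).*2 = (4 * k).+2); last by lia.
  by rewrite h2 h3; split; lia.
rewrite (_ : (0 + k.*2).*2 = 4 * k); last by lia.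
by split; lia.
Qed.

(** The constant 384 is 64 * 6, since [2 * sum_lin 4] enters with coefficient -6 and contains
    [odd n] once. *)
Lemma third_count_even n :
  64 * third_count n.*2 + 1296 * n.*2 ^ 3 + 2496 * n.*2 + 384 * odd n =
  160 * n.*2 ^ 4 + 3296 * n.*2 ^ 2.
Proof.
have [[[x y] z] /= [-> ex ey ez]] := third_countE n.*2.
have [+ _] := Peven2 n; have [+ _] := Pall3 n; have [+ _] := sum_lin_2 n.
have [+ _] := sum_lin2_1_2 n; have [+ _] := sum_lin2_2_2 n.
have [+ _] := even_gap_pairsE n; have [+ _] := gap_productsE n.
have := sum_ffact3E n.*2; have := ffact3 n; rewrite uphalf_double doubleK.
have [+ _] := sum_lin_4_parity n.
have p2 : n.*2 ^ 2 = 4 * n ^ 2 by lia.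
have p3 : n.*2 ^ 3 = 8 * n ^ 3 by lia.
have p4 : n.*2 ^ 4 = 16 * n ^ 4 by lia.
rewrite p2 p3 p4; move: ex ey ez.
(* With powers and sums replaced by unknowns the goal is linear. No value of [sum_lin 3] is
   supplied, because its coefficients cancel. *)
move: (n ^ 2) (n ^ 3) (n ^ 4) (nat_of_bool (odd n)) (sum_lin 4 _) (n ^_ 3) (sum_ffact3 _).
move: (gap_products _) (even_gap_pairs _) (sum_lin2 2 2 _) (sum_lin2 1 2 _) (sum_lin 2 _).
move: (sum_lin 3 _) (Pall 3 _) (Peven 2 _) x y z.
clear; lia.
Qed.

Lemma third_count_odd n : let l := n.*2.+1 in
  64 * third_count l + 1296 * l ^ 3 + 2736 * l = 160 * l ^ 4 + 3296 * l ^ 2 + 576.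
Proof.
move=> /=; set l := n.*2.+1; have [[[x y] z] /= [-> ex ey ez]] := third_countE l.
have [_ +] := Peven2 n; have [_ +] := Pall3 n; have [_ +] := sum_lin_2 n.
have [_ +] := sum_lin2_1_2 n; have [_ +] := sum_lin2_2_2 n.
have [_ +] := even_gap_pairsE n; have [_ +] := gap_productsE n.
have := sum_ffact3E l; have := ffact3 n; have := ffact3 n.+1.
rewrite {1 2}/l /= uphalf_double doubleK.
have [_ +] := sum_lin_4_parity n; rewrite -/l.
have p1 : l = 2 * n + 1 by rewrite /l; lia.
have p2 : l ^ 2 = 4 * n ^ 2 + 4 * n + 1 by rewrite p1; lia.
have p3 : l ^ 3 = 8 * n ^ 3 + 12 * n ^ 2 + 6 * n + 1 by rewrite p1; lia.
have p4 : l ^ 4 = 16 * n ^ 4 + 32 * n ^ 3 + 24 * n ^ 2 + 8 * n + 1 by rewrite p1; lia.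
have q2 : n.+1 ^ 2 = n ^ 2 + 2 * n + 1 by lia.
have q3 : n.+1 ^ 3 = n ^ 3 + 3 * n ^ 2 + 3 * n + 1 by lia.
rewrite q2 q3 p2 p3 p4; move: ex ey ez; rewrite p1.
move: (n ^ 2) (n ^ 3) (n ^ 4) (sum_lin 4 _) (n.+1 ^_ 3) (n ^_ 3) (sum_ffact3 _).
move: (gap_products _) (even_gap_pairs _) (sum_lin2 2 2 _) (sum_lin2 1 2 _) (sum_lin 2 _).
move: (sum_lin 3 _) (Pall 3 _) (Peven 2 _) x y z.
clear; lia.
Qed.

Local Open Scope ring_scope.

(** * Random signs *)

Section Signs.
Variables (R : comNzRingType) (l : nat).
Implicit Types (g : {ffun 'I_l -> bool}) (A B : {set 'I_l}).

Definition sgn g i : R := (-1) ^+ g i.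
Definition char g A : R := \prod_(i in A) sgn g i.

Lemma char_mul g A B : char g A * char g B = char g (symdiff A B).
Proof.
rewrite /char [X in X * _]big_mkcond [X in _ * X]big_mkcond [RHS]big_mkcond -big_split.
apply: eq_bigr => i _ /=; rewrite !inE; case: (i \in A); case: (i \in B) => /=; rewrite ?mulr1 ?mul1r //.
by rewrite /sgn -signr_addb addbb.
Qed.

Lemma sum_char A : \sum_g char g A = (2 ^ l * (A == set0))%:R.
Proof.
pose G i (b : bool) : R := if i \in A then (-1) ^+ b else 1.
transitivity (\sum_(g : {ffun 'I_l -> bool}) \prod_i G i (g i)).
  by apply: eq_bigr => g _; rewrite /char big_mkcond.
rewrite -bigA_distr_bigA /=.
have E i : \sum_b G i b = if i \in A then 0 else 2%:R.
  by rewrite big_bool /G; case: ifP => _ /=; rewrite ?expr1 ?expr0 ?addNr.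
have [A0|/set0Pn[i iA]] := eqVneq A set0.
  rewrite (eq_bigr (fun=> 2%:R)) => [|i _]; last by rewrite E A0 inE.
  by rewrite prodr_const card_ord muln1 natrX.
by rewrite muln0 (bigD1 i) //= E iA mul0r.
Qed.

(** The variable T of the overview. The empty set has weight 0, so T has mean 0. *)
Definition walsh g : R := \sum_A char g A *+ weight A.

Lemma symdiff_eq0 A B : (symdiff A B == set0) = (B == A).
Proof. by rewrite /symdiff setU_eq0 !setD_eq0 eqEsubset andbC. Qed.

Lemma weight_set0 : weight (@set0 'I_l) = 0%N.
Proof.
rewrite /weight /weight2 cards0 /= add0n; apply/eqP; apply: contraT => /weight4_card.
by rewrite cards0.
Qed.

Lemma sum_walsh : \sum_g walsh g = 0.
Proof.
rewrite exchange_big big1 //= => A _; rewrite sumrMnl sum_char -mulrnA.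
by case: eqP => [->|_]; rewrite ?weight_set0 ?muln0 // muln0 mul0n.
Qed.

Lemma sum_walsh_sq : \sum_g walsh g ^+ 2 = (2 ^ l * \sum_(A : {set 'I_l}) weight A ^ 2)%:R.
Proof.
transitivity (\sum_A \sum_B (\sum_g char g (symdiff A B)) * (weight A * weight B)%:R).
  under [RHS]eq_bigr => A _ do (under eq_bigr do rewrite mulr_suml; rewrite exchange_big /=).
  rewrite exchange_big; apply: eq_bigr => g _ /=.
  rewrite expr2 mulr_suml; apply: eq_bigr => A _; rewrite mulr_sumr; apply: eq_bigr => B _.
  rewrite -char_mul; move: (char g A) (char g B) (weight A) (weight B) => x y m n.
  by rewrite -(mulr_natr x) -(mulr_natr y) natrM; ring.
rewrite big_distrr natr_sum; apply: eq_bigr => A _ /=.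
rewrite (bigD1 A) //= sum_char symdiff_eq0 eqxx big1 => [|B BA].
  by rewrite addr0 muln1 -natrM mulnn.
by rewrite sum_char symdiff_eq0 (negbTE BA) muln0 mul0r.
Qed.

Lemma sum_walsh_cube : \sum_g walsh g ^+ 3 = (2 ^ l * third_count l)%:R.
Proof.
transitivity
  (\sum_A \sum_B \sum_C (\sum_g char g (symdiff (symdiff A B) C)) * (weight A * weight B * weight C)%:R).
  under [RHS]eq_bigr => A _ do under eq_bigr => B _ do
    (under eq_bigr do rewrite mulr_suml; rewrite exchange_big /=).
  under [RHS]eq_bigr => A _ do rewrite exchange_big /=.
  rewrite exchange_big; apply: eq_bigr => g _ /=.
  rewrite exprS expr2 mulr_suml; apply: eq_bigr => A _.
  rewrite mulr_suml mulr_sumr; apply: eq_bigr => B _; rewrite !mulr_sumr; apply: eq_bigr => C _.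
  rewrite -(char_mul g (symdiff A B)) -char_mul.
  move: (char g A) (char g B) (char g C) (weight A) (weight B) (weight C) => x y z m n p.
  by rewrite -(mulr_natr x) -(mulr_natr y) -(mulr_natr z) !natrM; ring.
rewrite /third_count /triple_sum big_distrr natr_sum; apply: eq_bigr => A _.
rewrite big_distrr natr_sum; apply: eq_bigr => B _ /=.
rewrite (bigD1 (symdiff A B)) //= sum_char symdiff_eq0 eqxx big1 => [|C CA].
  by rewrite addr0 muln1 -natrM.
by rewrite sum_char symdiff_eq0 (negbTE CA) muln0 mul0r.
Qed.

Lemma char_pset g (p : 'I_l * 'I_l) : asc p -> char g (pset p) = sgn g p.1 * sgn g p.2.
Proof. by move=> pp; rewrite /char /pset big_setU1 ?inE ?asc_neq //= big_set1. Qed.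

Lemma char_sq g A : char g A * char g A = 1.
Proof.
rewrite char_mul (_ : symdiff A A = set0) ?/char ?big_set0 //.
by apply/eqP; rewrite symdiff_eq0.
Qed.

Definition pair_sum g s : R := \sum_(p : 'I_l * 'I_l | asc p && (psum p == s)) char g (pset p).
Definition diag_count s : nat := \sum_(a < l) (a.*2 == s).

(** Each pair a < b is met in both orders, and each diagonal term is a squared sign, equal to 1. *)
Lemma sum_antidiag g s :
  \sum_(a < l) \sum_(b < l | (a + b == s)%N) sgn g a * sgn g b =
  pair_sum g s *+ 2 + (diag_count s)%:R.
Proof.
have T : \sum_(a < l) \sum_(b < l | (a < b)%N)
    (if (a + b == s)%N then sgn g a * sgn g b else 0) = pair_sum g s.
  rewrite pair_big_dep /= /pair_sum big_mkcondr; apply: eq_bigr => -[a b] ab /=.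
  by rewrite /psum /= char_pset.
rewrite mulr2n -[X in X + _ + _]T -[X in _ + X + _]T [X in _ = _ + X + _](exchange_big_dep xpredT) //=.
rewrite natr_sum -!big_split; apply: eq_bigr => a _ /=.
rewrite big_mkcond [X in X + _ + _]big_mkcond [X in _ + X + _]big_mkcond -big_split /=.
rewrite (bigD1 a) //= [X in _ = X + _](bigD1 a) //= ltnn addnn /= addr0.
rewrite addrAC; congr (_ + _).
  by rewrite add0r; case: eqP => //=; rewrite /sgn -signr_addb addbb.
apply: eq_bigr => b; rewrite -val_eqE /= (addnC b) (mulrC (sgn g b)).
by case: ltngtP => //; rewrite ?addr0 ?add0r.
Qed.

(** The quantity N of the overview, grouped by the common value s of a + b and c + d. *)
Definition energy g : R :=
  \sum_(s < l.*2) (\sum_(a < l) \sum_(b < l | (a + b == s)%N) sgn g a * sgn g b) ^+ 2.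

Definition energy_const : nat :=
  (4 * #|@asc l| + \sum_(s < l.*2) diag_count s ^ 2)%N.

(** Each summand is (2P + D)^2 = 4P^2 + 4PD + D^2. The square P^2 yields constants and the
    quadruples, and PD yields the pairs of even sum. *)
Lemma energyE g : energy g = energy_const%:R + walsh g *+ 4.
Proof.
have sgl (p : 'I_l * 'I_l) : (psum p < l.*2)%N.
  by rewrite /psum; have := ltn_ord p.1; have := ltn_ord p.2; lia.
have walsh_split : walsh g = \sum_A char g A *+ weight2 A + \sum_A char g A *+ weight4 A.
  by rewrite -big_split; apply: eq_bigr => A _; rewrite /weight mulrnDr.
have P2 : \sum_(s < l.*2) pair_sum g s ^+ 2 = #|@asc l|%:R + \sum_A char g A *+ weight4 A.
  rewrite sum_weight4_join -sum1_card natr_sum -big_split /=.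
  transitivity (\sum_(p | @asc l p) \sum_(q | @asc l q && (psum p == psum q))
      char g (pset p) * char g (pset q)).
    transitivity (\sum_(s < l.*2) \sum_(p | @asc l p && (psum p == s)) char g (pset p) * pair_sum g s).
      by apply: eq_bigr => s _; rewrite expr2 {1}/pair_sum mulr_suml.
    rewrite (exchange_big_dep (@asc l)) /=; last by move=> s p _ /andP[].
    apply: eq_bigr => p pp; rewrite (big_pred1 (Ordinal (sgl p))); last first.
      by move=> s; rewrite pp /= -val_eqE eq_sym.
    by rewrite /pair_sum mulr_sumr; apply: eq_bigl => q; rewrite /= [psum q == _]eq_sym.
  apply: eq_bigr => p pp; rewrite (bigD1 p) ?pp ?eqxx //= char_sq; congr (_ + _).
  rewrite big_mkcond [RHS]big_mkcond; apply: eq_bigr => q _.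
  case: (boolP (asc q)) => //= pq; case: eqP => e /=; last by case: ifP.
  case: ifP => // qp; rewrite mulr1n char_mul; congr char.
  have apq : apart p q by rewrite (apart_neq pp pq) ?qp //; apply/eqP.
  move: apq; rewrite -disj_pset => d; rewrite /symdiff (setDidPl d).
  by rewrite (setDidPl _) // disjoint_sym.
have P1 : \sum_(s < l.*2) pair_sum g s *+ diag_count s = \sum_A char g A *+ weight2 A.
  rewrite (bigID (fun A : {set 'I_l} => #|A| == 2)) /= [X in _ + X]big1 ?addr0; last first.
    by move=> A /negbTE cA; rewrite /weight2 cA.
  rewrite sum_card2.
  under eq_bigr do rewrite /pair_sum -sumrMnl.
  rewrite (exchange_big_dep (@asc l)) /=; last by move=> s p _ /andP[].
  apply: eq_bigr => p pp; rewrite (big_pred1 (Ordinal (sgl p))) /=; last first.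
    by move=> s; rewrite pp /= -val_eqE eq_sym.
  rewrite weight2E ?asc_neq //; congr (_ *+ _); rewrite /diag_count -/(psum p).
  (* The diagonal meets the line a + b = s only at s / 2, hence once for even s and never for odd
     s. *)
  transitivity (~~ odd (psum p) * \sum_(a < l) (a == (psum p)./2 :> nat))%N.
    rewrite big_distrr; apply: eq_bigr => a _ /=.
    by have := odd_double_half (psum p); case: odd => /=; lia.
  rewrite sum_ord_eq; have := odd_double_half (psum p); have := sgl p.
  by case: odd => /=; lia.
rewrite /energy; under eq_bigr do rewrite sum_antidiag.
have E s : (pair_sum g s *+ 2 + (diag_count s)%:R) ^+ 2 =
    4%:R * pair_sum g s ^+ 2 + 4%:R * (pair_sum g s *+ diag_count s) + (diag_count s ^ 2)%:R.
  by rewrite natrX -(mulr_natr (pair_sum g s) (diag_count s)); ring.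
under eq_bigr do rewrite E.
rewrite !big_split /= -!mulr_sumr P1 P2 /energy_const natrD natrM natr_sum.
by rewrite walsh_split; ring.
Qed.

End Signs.

Unset Implicit Arguments.
Set Strict Implicit.

From mathcomp Require Import finmap complex.
From mathcomp Require Import all_classical all_reals all_analysis.
Import Order.TTheory Num.Theory.

(** * Binary sequences *)

Section Sequences.
Variables (R : realType) (l : nat).
Implicit Types g : {ffun 'I_l -> bool}.

Lemma sum_sq_fibres (T : finType) (h : T -> nat) n (y : T -> R) : (forall p, (h p < n)%N) ->
  \sum_(t < n) (\sum_(p | h p == t) y p) ^+ 2 = \sum_p \sum_(q | h p == h q) y p * y q.
Proof.
move=> hn; under eq_bigr do rewrite expr2 mulr_suml.
rewrite (exchange_big_dep xpredT) //=; apply: eq_bigr => p _.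
rewrite (big_pred1 (Ordinal (hn p))); last by move=> t; rewrite /= -val_eqE /= eq_sym.
by rewrite mulr_sumr; apply: eq_bigl => q; rewrite /= eq_sym.
Qed.

(** Written as a sum, the entry is defined at every integer without a proof that j is in range. *)
Definition entry g (j : int) : R := \sum_(a < l) if a%:Z == j then sgn R g a else 0.

Lemma entry_ord g (a : 'I_l) : entry g a%:Z = sgn R g a.
Proof.
rewrite /entry (bigD1 a) //= eqxx big1 ?addr0 // => b ba.
by rewrite eqz_nat (inj_eq val_inj) (negbTE ba).
Qed.

Lemma entry_out g (j : int) : ~~ (0 <= j < l%:Z) -> entry g j = 0.
Proof.
move=> jl; rewrite /entry big1 // => a _; case: eqP => // e.
by move: jl; rewrite -e lez_nat ltz_nat ltn_ord.
Qed.

Definition seq_of g : cseq R :=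
  [fsfun j in [fset (nat_of_ord a)%:Z | a in 'I_l]%fset => (entry g j)%:C%C].

Lemma seq_ofE g j : seq_of g j = (entry g j)%:C%C.
Proof.
rewrite /seq_of fsfunE; case: ifP => // /negbT jD; rewrite entry_out //.
apply: contra jD => /andP[]; case: j => // j _; rewrite ltz_nat => jl.
by apply/imfsetP; exists (Ordinal jl).
Qed.

Definition corr g (s : int) : R := \sum_(b < l) entry g (b%:Z + s) * sgn R g b.

Lemma fsum_int (V : nmodType) (F : int -> V) (P : {pred int}) (r : seq int) : uniq r ->
  (forall j, P j -> j \notin r -> F j = 0) ->
  \sum_(j \in [set j | P j]%classic) F j = \sum_(j <- r | P j) F j.
Proof. by move=> ur F0; rewrite (bigfs _ ur F0). Qed.

Lemma autocorr_seq_of g s : autocorr (seq_of g) s = (corr g s)%:C%C.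
Proof.
rewrite /autocorr (_ : [set: int]%classic = [set j | predT j]%classic); last by apply/seteqP.
rewrite (@fsum_int _ _ _ [seq t%:Z | t <- iota 0 l]).
- rewrite big_map -[l in iota 0 l]subn0 -/(index_iota 0 l) big_mkord rmorph_sum; apply: eq_bigr => b _.
  by rewrite !seq_ofE entry_ord rmorphM; congr (_ * _); exact: conjc_real.
- by rewrite map_inj_uniq ?iota_uniq // => x y [].
- move=> j _ jr; rewrite !seq_ofE (entry_out g j) ?rmorph0 ?mulr0 //.
  apply: contra jr => /andP[]; case: j => // j _; rewrite ltz_nat => jl.
  by apply/mapP; exists j; rewrite // mem_iota.
Qed.

Lemma corr0 g : corr g 0 = l%:R.
Proof.
rewrite /corr (eq_bigr (fun=> 1)) ?sumr_const ?card_ord // => b _.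
by rewrite addr0 entry_ord /sgn -signr_addb addbb.
Qed.

Lemma corr_out g s : ~~ (- l%:Z < s < l%:Z) -> corr g s = 0.
Proof.
move=> sl; rewrite /corr big1 // => b _; rewrite entry_out ?mul0r //.
by apply: contra sl => /andP[]; have := ltn_ord b; lia.
Qed.

(** Shifts are offset by l so that a - b becomes a natural number; t < 2l covers every shift with a
    nonzero correlation. *)
Lemma corr_shift g (t : nat) :
  corr g (t%:Z - l%:Z) = \sum_(p : 'I_l * 'I_l | (p.1 + l - p.2 == t)%N) sgn R g p.1 * sgn R g p.2.
Proof.
rewrite /corr; under eq_bigr do rewrite /entry mulr_suml.
rewrite exchange_big pair_big_dep /= [RHS]big_mkcond; apply: eq_bigr => -[a b] _ /=.
rewrite (_ : (a%:Z == _) = (a + l - b == t)%N); first by case: ifP => // _; rewrite mul0r.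
by have := ltn_ord b; lia.
Qed.

Lemma sum_corr_sq g : \sum_(t < l.*2) corr g (t%:Z - l%:Z) ^+ 2 = energy R g.
Proof.
under eq_bigr do rewrite corr_shift.
rewrite (sum_sq_fibres _ (fun p : 'I_l * 'I_l => p.1 + l - p.2)%N); last first.
  by move=> [a b] /=; have := ltn_ord a; lia.
rewrite /energy; under [RHS]eq_bigr do rewrite pair_big_dep /=.
rewrite (sum_sq_fibres _ (fun p : 'I_l * 'I_l => p.1 + p.2)%N); last first.
  by move=> [a b] /=; have := ltn_ord a; have := ltn_ord b; lia.
rewrite !pair_big_dep /=.
(* [a - b = c - d] if and only if [a + d = c + b]. *)
pose h (x : ('I_l * 'I_l) * ('I_l * 'I_l)) := ((x.1.1, x.2.2), (x.2.1, x.1.2)).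
have hK : involutive h by move=> [[a b] [c d]].
rewrite (reindex_inj (inv_inj hK)); apply: eq_big => [[[a b] [c d]]|[[a b] [c d]] _] /=.
  by have := ltn_ord b; have := ltn_ord d; lia.
by rewrite mulrACA [sgn R g d * _]mulrC mulrACA (mulrC (sgn R g c)).
Qed.

Hypothesis l0 : (0 < l)%N.

Lemma ADF_seq_of g : ADF (seq_of g) = (energy R g - l%:R ^+ 2) / l%:R ^+ 2.
Proof.
pose r := [seq t%:Z - l%:Z | t <- iota 0 l.*2].
have ur : uniq r by rewrite map_inj_uniq ?iota_uniq // => x y /addIr [].
have r0 : 0 \in r by apply/mapP; exists l; rewrite ?subrr // mem_iota; lia.
have nE s : `|autocorr (seq_of g) s| ^+ 2 = (corr g s ^+ 2)%:C%C.
  by rewrite autocorr_seq_of normCK rmorphXn expr2; congr (_ * _); exact: conjc_real.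
rewrite /ADF (fsum_int _ _ (fun s => s != 0) r ur); last first.
  move=> s s0 sr; rewrite nE corr_out ?expr0n ?rmorph0 //.
  apply: contra sr => sl; apply/mapP; exists (absz (s + l%:Z)); last by lia.
  by rewrite mem_iota; lia.
under eq_bigr do rewrite nE.
rewrite -rmorph_sum autocorr_seq_of corr0 -rmorphXn -fmorph_div /=; congr (_ / _).
(* The term at shift 0, equal to l^2, is put back to complete the sum over all shifts in [r]. *)
apply/eqP; rewrite eq_sym subr_eq -sum_corr_sq addrC -(corr0 g).
rewrite -(bigD1_seq _ r0 ur (F := fun s => corr g s ^+ 2)) //=.
by rewrite big_map -[X in iota 0 X]subn0 -/(index_iota 0 l.*2) big_mkord.
Qed.

Lemma seq_of_inj : injective seq_of.
Proof.
move=> g g' e; apply/ffunP => a.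
have := congr1 (fun f : cseq R => f a%:Z) e; rewrite !seq_ofE !entry_ord => -[].
by move=> /signr_inj.
Qed.

Lemma binary_seqsE : binary_seqs R l = (seq_of @` [set: {ffun 'I_l -> bool}])%classic.
Proof.
apply/seteqP; split => [f fb|_ [g _ <-]] /=; last first.
  move=> j; rewrite seq_ofE; case: ifP => [/andP[]|/negbT jl]; last by rewrite entry_out.
  case: j => // j _; rewrite ltz_nat => jl; rewrite (entry_ord g (Ordinal jl)) /sgn rmorph_sign.
  by case: (g _); [right; rewrite expr1|left; rewrite expr0].
exists [ffun a : 'I_l => f a%:Z == -1] => //; apply/fsfunP => j; rewrite seq_ofE.
have := fb j; case: ifP => [/andP[]|/negbT jl ->]; last by rewrite entry_out.
case: j => // j _; rewrite ltz_nat => jl.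
rewrite (entry_ord _ (Ordinal jl)) /sgn ffunE /= rmorph_sign.
case=> ->; rewrite ?eqxx ?expr1 //.
suff -> : (1 == -1 :> R[i]) = false by [].
by rewrite eq_sym -subr_eq0 -opprD oppr_eq0 (pnatr_eq0 _ 2).
Qed.

Lemma expectation_seqE (v : cseq R -> R) :
  expectation_seq l v = (\sum_g v (seq_of g)) / (2 ^ l)%:R.
Proof.
have E (u : cseq R -> R) : \sum_(f \in binary_seqs R l) u f = \sum_g u (seq_of g).
  rewrite binary_seqsE fsbig_image; last by move=> x y _ _; exact: seq_of_inj.
  rewrite (bigfs _ (index_enum_uniq _) (P := predT)); last by move=> g _; rewrite mem_index_enum.
  by apply: eq_fsbigl; apply/seteqP; split.
rewrite /expectation_seq E; congr (_ / _).
have fin : finite_set (binary_seqs R l) by rewrite binary_seqsE; apply: finite_image.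
(* The constant function 1 in [E] gives the cardinality of the set of sequences. *)
have := E (fun=> 1); rewrite fsbig_finite // sumr_const card_ffun card_bool card_ord => <-.
by rewrite big_const_seq count_predT iter_addr addr0.
Qed.

(** The constant may stay unnamed: it is the mean, and central moments remove it. *)
Lemma ADF_walsh : exists c : R, forall g, ADF (seq_of g) = c + 4 / l%:R ^+ 2 * walsh R g.
Proof.
exists ((energy_const l)%:R / l%:R ^+ 2 - 1) => g; rewrite ADF_seq_of energyE.
have : (l%:R : R) != 0 by rewrite pnatr_eq0 -lt0n.
by rewrite -[walsh R g *+ 4]mulr_natr => ?; field.
Qed.

Lemma central_momentE p :
  central_moment_seq p l (@ADF R) =
  (4 / l%:R ^+ 2) ^+ p * ((\sum_(g : {ffun 'I_l -> bool}) walsh R g ^+ p) / (2 ^ l)%:R).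
Proof.
have [c cE] := ADF_walsh.
have pow0 : ((2 ^ l)%:R : R) != 0 by rewrite pnatr_eq0 -lt0n expn_gt0.
have mean : expectation_seq l (@ADF R) = c.
  rewrite expectation_seqE; under eq_bigr do rewrite cE.
  rewrite big_split /= -mulr_sumr sum_walsh mulr0 addr0 sumr_const card_ffun card_bool card_ord.
  by rewrite -[c *+ _]mulr_natr mulfK.
rewrite /central_moment_seq mean expectation_seqE mulrA mulr_sumr; congr (_ / _).
by apply: eq_bigr => g _; rewrite cE addrC addKr exprMn.
Qed.

Definition weight_sq_sum : nat := \sum_(A : {set 'I_l}) weight A ^ 2.

Lemma variance_ADF : central_moment_seq 2 l (@ADF R) = 16 * weight_sq_sum%:R / l%:R ^+ 4.
Proof.
have l1 : (l%:R : R) != 0 by rewrite pnatr_eq0 -lt0n.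
have pow0 : ((2 ^ l)%:R : R) != 0 by rewrite pnatr_eq0 -lt0n expn_gt0.
rewrite central_momentE sum_walsh_sq natrM -/weight_sq_sum; move: (2 ^ l)%:R pow0 => x x0.
by move: weight_sq_sum%:R => y; field; rewrite l1 x0.
Qed.

Lemma third_moment_ADF :
  central_moment_seq 3 l (@ADF R) = 64 * (third_count l)%:R / l%:R ^+ 6.
Proof.
have l1 : (l%:R : R) != 0 by rewrite pnatr_eq0 -lt0n.
have pow0 : ((2 ^ l)%:R : R) != 0 by rewrite pnatr_eq0 -lt0n expn_gt0.
rewrite central_momentE sum_walsh_cube natrM; move: (2 ^ l)%:R pow0 => x x0.
by move: (third_count l)%:R => y; field; rewrite l1 x0.
Qed.

Lemma skewness_ADF :
  std_moment_seq 3 l (@ADF R) =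
  6 * Num.sqrt 3 * (4 * (third_count l)%:R) / (12 * weight_sq_sum%:R) `^ (3 / 2).
Proof.
have l1 : 0 < (l%:R : R) by rewrite ltr0n.
have s3 : 0 < Num.sqrt 3 :> R by rewrite sqrtr_gt0.
have s3q : Num.sqrt 3 ^+ 2 = 3 :> R by rewrite sqr_sqrtr.
rewrite /std_moment_seq variance_ADF third_moment_ADF.
(* The variance is [c ^+ 2] times the polynomial of the denominator. *)
set c : R := 2 / (Num.sqrt 3 * l%:R ^+ 2).
have c0 : 0 < c by rewrite divr_gt0 // mulr_gt0 // exprn_gt0.
have -> : 16 * weight_sq_sum%:R / l%:R ^+ 4 = c ^+ 2 * (12 * weight_sq_sum%:R).
  rewrite /c expr_div_n exprMn s3q; field; exact: lt0r_neq0.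
have c_ge0 := ltW c0; have d_ge0 : 0 <= 12 * weight_sq_sum%:R :> R by rewrite mulr_ge0.
rewrite (powRM _ (exprn_ge0 2 c_ge0) d_ge0) -(powR_mulrn 2 c_ge0) -powRrM.
rewrite (_ : 2%:R * (3%:R / 2) = 3%:R); last by field.
rewrite powR_mulrn //; move: (_ `^ _) => D.
have -> : 64 * (third_count l)%:R / l%:R ^+ 6 = 6 * Num.sqrt 3 * (4 * (third_count l)%:R) * c ^+ 3.
  rewrite /c expr_div_n exprMn [Num.sqrt 3 ^+ 3]exprS s3q.
  by field; rewrite !lt0r_neq0.
(* [invfM] also holds for D = 0, so the lengths 1 and 2, where the variance vanishes, need no
   separate case. *)
by move: (6 * _ * _) => x; rewrite invfM mulrA mulfK // expf_neq0 // lt0r_neq0.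
Qed.

End Sequences.

(** * Residue classes modulo 4 and the final formulas *)

Lemma mod4_parity l :
  [/\ (l = 0 %[mod 4])%N -> exists2 n, l = n.*2 & ~~ odd n,
      (l = 1 %[mod 4])%N \/ (l = 3 %[mod 4])%N -> exists n, l = n.*2.+1 &
      (l = 2 %[mod 4])%N -> exists2 n, l = n.*2 & odd n].
Proof.
split=> h; [exists (l %/ 4)%N.*2 | exists (l %/ 2)%N | exists (l %/ 4)%N.*2.+1]; rewrite /= ?odd_double //;
  lia.
Qed.

(** The integer identities divided by 16, the normalisation in the numerator of the skewness; 16
    times it gives the third moment. *)
Lemma third_count_real (R : realType) l (x : R := l%:R) :
  [/\ (l = 0 %[mod 4])%N ->
        4 * (third_count l)%:R = 10 * x ^+ 4 - 81 * x ^+ 3 + 206 * x ^+ 2 - 156 * x,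
      (l = 1 %[mod 4])%N \/ (l = 3 %[mod 4])%N ->
        4 * (third_count l)%:R = 10 * x ^+ 4 - 81 * x ^+ 3 + 206 * x ^+ 2 - 171 * x + 36 &
      (l = 2 %[mod 4])%N ->
        4 * (third_count l)%:R = 10 * x ^+ 4 - 81 * x ^+ 3 + 206 * x ^+ 2 - 156 * x - 24].
Proof.
have [m0 m1 m2] := mod4_parity l.
split=> h.
- have [n ln on] := m0 h; have := third_count_even n.
  rewrite -ln (negbTE on) muln0 addn0 => /(congr1 (fun k => k%:R : R)).
  by rewrite /x; move: (third_count l) => t; lra.
- have [n ln] := m1 h; have := third_count_odd n; rewrite -ln /= => /(congr1 (fun k => k%:R : R)).
  by rewrite /x; move: (third_count l) => t; lra.
- have [n ln on] := m2 h; have := third_count_even n.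
  rewrite -ln on muln1 => /(congr1 (fun k => k%:R : R)).
  by rewrite /x; move: (third_count l) => t; lra.
Qed.

Lemma weight_sq_sum_real (R : realType) l (x : R := l%:R) :
  12 * (weight_sq_sum l)%:R = 4 * x ^+ 3 - 15 * x ^+ 2 + 14 * x - (3 * odd l)%:R.
Proof.
rewrite /weight_sq_sum; have [n [ln|ln]] : exists n, l = n.*2 \/ l = n.*2.+1.
- by exists l./2; have := odd_double_half l; case: odd => /=; [right|left]; lia.
- have [+ _] := variance_count n; rewrite -ln => /(congr1 (fun k => k%:R : R)).
  rewrite (_ : odd l = false) ?muln0; last by rewrite ln odd_double.
  by rewrite /x; move: (\sum_(A : {set _}) _)%N => y; lra.
- have [_ +] := variance_count n; rewrite -ln => /(congr1 (fun k => k%:R : R)).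
  rewrite (_ : odd l = true) ?muln1; last by rewrite ln /= odd_double.
  by rewrite /x; move: (\sum_(A : {set _}) _)%N => y; lra.
Qed.

Theorem theorem1p3 (R : realType) (l : nat) (hl : (0 < l)%N) :
  let x : R := l%:R in
  ((l = 0 %[mod 4])%N ->
     central_moment_seq 3 l (@ADF R) =
       (160 * x ^+ 4 - 1296 * x ^+ 3 + 3296 * x ^+ 2 - 2496 * x) / x ^+ 6 /\
     std_moment_seq 3 l (@ADF R) =
       6 * Num.sqrt 3 * (10 * x ^+ 4 - 81 * x ^+ 3 + 206 * x ^+ 2 - 156 * x)
       / (4 * x ^+ 3 - 15 * x ^+ 2 + 14 * x) `^ (3 / 2)) /\
  ((l = 1 %[mod 4])%N \/ (l = 3 %[mod 4])%N ->
     central_moment_seq 3 l (@ADF R) =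
       (160 * x ^+ 4 - 1296 * x ^+ 3 + 3296 * x ^+ 2 - 2736 * x + 576)
       / x ^+ 6 /\
     std_moment_seq 3 l (@ADF R) =
       6 * Num.sqrt 3 *
         (10 * x ^+ 4 - 81 * x ^+ 3 + 206 * x ^+ 2 - 171 * x + 36)
       / (4 * x ^+ 3 - 15 * x ^+ 2 + 14 * x - 3) `^ (3 / 2)) /\
  ((l = 2 %[mod 4])%N ->
     central_moment_seq 3 l (@ADF R) =
       (160 * x ^+ 4 - 1296 * x ^+ 3 + 3296 * x ^+ 2 - 2496 * x - 384)
       / x ^+ 6 /\
     std_moment_seq 3 l (@ADF R) =
       6 * Num.sqrt 3 *
         (10 * x ^+ 4 - 81 * x ^+ 3 + 206 * x ^+ 2 - 156 * x - 24)
       / (4 * x ^+ 3 - 15 * x ^+ 2 + 14 * x) `^ (3 / 2)).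
Proof.
move=> x; have [c0 c1 c2] := third_count_real R l; have [m0 m1 m2] := mod4_parity l.
have v := weight_sq_sum_real R l; rewrite -/x in c0 c1 c2 v.
rewrite third_moment_ADF // skewness_ADF // v.
have q : 64 * (third_count l)%:R = 16 * (4 * (third_count l)%:R) :> R.
  by move: (third_count l)%:R => t; ring.
rewrite q -/x; split; [|split]; move=> h.
- have [n ln on] := m0 h; rewrite (c0 h) (_ : odd l = false) ?muln0 ?subr0;
    last by rewrite ln odd_double.
  by split => //; congr (_ / _); ring.
- have [n ln] := m1 h; rewrite (c1 h) (_ : odd l = true) ?muln1; last by rewrite ln /= odd_double.
  by split => //; congr (_ / _); ring.
- have [n ln on] := m2 h; rewrite (c2 h) (_ : odd l = false) ?muln0 ?subr0;
    last by rewrite ln odd_double.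
  by split => //; congr (_ / _); ring.
Qed.
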